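(* Let $1\le p<2$. There are constants $c_0,c>0$ such that for all $n,N\in\mathbb{N}$ with $n\ge c_0\sqrt{N}$, $$ e_n^q(S_N,\mathcal{B}_p^N)\le c\, n^{-2/p}N^{2/p-1}\max\big(\log(n/\sqrt{N}),1\big)^{2/p-1}. $$
   Context: Throughout, $\log=\log_2$, $\mathbb{N}=\{1,2,\dots\}$, $\mathbb{N}_0=\mathbb{N}\cup\{0\}$, and $\mathbb{Z}[0,N)=\{0,\dots,N-1\}$. Quantum model. Let $D,K$ be nonempty sets, $F$ a nonempty set of functions $D\to K$, $G$ a normed space over $\mathbb{R}$ or $\mathbb{C}$, and $S:F\to G$. Let $H_m=(\mathbb{C}^2)^{\otimes m}$ with canonical basis $|i\rangle$, $i\in\mathbb{Z}[0,2^m)$ (via binary expansion). A quantum query is a tuple $Q=(m,m',m'',Z,\tau,\beta)$ with $m,m',m''\in\mathbb{N}$, $m'+m''\le m$, $\emptyset\ne Z\subseteq\mathbb{Z}[0,2^{m'})$, $\tau:Z\to D$, $\beta:K\to\mathbb{Z}[0,2^{m''})$. For $f\in F$ the unitary $Q_f$ on $H_m=H_{m'}\otimes H_{m''}\otimes H_{m-m'-m''}$ is given on basis states by $Q_f|i\rangle|x\rangle|y\rangle=|i\rangle|x\oplus\beta(f(\tau(i)))\rangle|y\rangle$ if $i\in Z$ and $Q_f|i\rangle|x\rangle|y\rangle=|i\rangle|x\rangle|y\rangle$ otherwise, where $\oplus$ is addition mod $2^{m''}$. A quantum algorithm with no measurement is $(Q,(U_j)_{j=0}^n)$ with $n\in\mathbb{N}_0$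 and unitaries $U_j$ on $H_{m}$, $m=m(Q)$; it defines $A_f=U_nQ_fU_{n-1}\cdots U_1Q_fU_0$ and uses $n$ queries; $A_f(x,y)$ denotes its matrix entries in the canonical basis. A quantum algorithm from $F$ to $G$ with $k\in\mathbb{N}$ measurements is $A=((A_\ell)_{\ell=0}^{k-1},(b_\ell)_{\ell=0}^{k-1},\varphi)$, where each $A_\ell$ is an algorithm with no measurement on $m_\ell$ qubits, $b_0\in\mathbb{Z}[0,2^{m_0})$, $b_\ell:\prod_{i<\ell}\mathbb{Z}[0,2^{m_i})\to\mathbb{Z}[0,2^{m_\ell})$ for $1\le\ell\le k-1$, and $\varphi:\prod_{\ell<k}\mathbb{Z}[0,2^{m_\ell})\to G$. Its output on $f$ is the probability measure $A(f)$ on $G$ which is the distribution of $\varphi(x_0,\dots,x_{k-1})$, where $(x_0,\dots,x_{k-1})$ has probability $\prod_{\ell=0}^{k-1}|A_{\ell,f}(x_\ell,b_\ell(x_0,\dots,x_{\ell-1}))|^2$ (with $b_0$ a constant). Its number of queries is $n_q(A)=\sum_\ell n_q(A_\ell)$. For a random variable $\zeta$ with distribution $A(f)$, let $e(S,A,f)=\inf\{\varepsilon:\ \mathbf{P}\{\|S(f)-\zeta\|>\varepsilon\}\le 1/4\}$, $e(S,A,F)=\sup_{f\in F}e(S,A,f)$, and the $n$-th minimal query error is $e_n^q(S,F)=\inf\{e(S,A,F): A \text{ a quantum algorithm from } F \text{ to } G \text{ with } n_q(A)\le n\}$. Summation setting. For $N\in\mathbb{N}$, $D=\mathbb{Z}[0,N)$,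 $K=G=\mathbb{R}$. For $1\le p<\infty$, $L_p^N$ is the space of functions $f:\mathbb{Z}[0,N)\to\mathbb{R}$ with norm $\|f\|_{L_p^N}=\big(\frac1N\sum_{i=0}^{N-1}|f(i)|^p\big)^{1/p}$; $\mathcal{B}_p^N=\{f\in L_p^N:\|f\|_{L_p^N}\le 1\}$; and $S_N f=\frac1N\sum_{i=0}^{N-1}f(i)$. *)

(* Defs.v *)
From HB Require Import structures.
From mathcomp Require Import all_boot all_order all_algebra.
From mathcomp Require Import all_classical all_reals.
From mathcomp Require Import ereal exp.
From mathcomp Require Import complex.
Set Implicit Arguments. Unset Strict Implicit. Unset Printing Implicit Defensive.
Import Order.TTheory GRing.Theory Num.Theory.
Local Open Scope ring_scope.


Notation cpx := complex.complex.

Section QuantumModel.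
Variable R : realType.

Definition sqnorm (z : cpx R) : R := (complex.Re z) ^+ 2 + (complex.Im z) ^+ 2.

Definition unitary (d : nat) (U : 'M[cpx R]_d) : Prop :=
  U *m (map_mx (@complex.conjc R) U)^T = 1%:M.

Definition mxnat (d : nat) (M : 'M[cpx R]_d) (x y : nat) : cpx R :=
  match insub x, insub y with
  | Some i, Some j => M i j
  | _, _ => 0
  end.

Record query (N : nat) := Query {
  q_m : nat; q_m1 : nat; q_m2 : nat;
  q_Z : {set 'I_(2 ^ q_m1)};
  q_tau : 'I_(2 ^ q_m1) -> 'I_N;      (* only its values on Z matter *)
  q_beta : R -> 'I_(2 ^ q_m2);
  q_m_pos : (0 < q_m)%N; q_m1_pos : (0 < q_m1)%N; q_m2_pos : (0 < q_m2)%N;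
  q_le : (q_m1 + q_m2 <= q_m)%N;
  q_Z_nonempty : q_Z != finset.set0 }.

(* Basis-state action of Q_f on H_m = H_m' (x) H_m'' (x) H_(m-m'-m''),
   with |i>|x>|y> = |i * 2^(m-m') + x * 2^(m-m'-m'') + y>. *)
Definition qmap (N : nat) (Q : query N) (f : 'I_N -> R) (a : nat) : nat :=
  let r := (q_m Q - q_m1 Q - q_m2 Q)%N in
  let i := (a %/ 2 ^ (q_m Q - q_m1 Q))%N in
  let x := ((a %/ 2 ^ r) %% 2 ^ q_m2 Q)%N in
  let y := (a %% 2 ^ r)%N in
  match (insub i : option 'I_(2 ^ q_m1 Q)) with
  | Some i' =>
      if i' \in q_Z Q then
        (i * 2 ^ (q_m Q - q_m1 Q)
         + ((x + q_beta Q (f (@q_tau _ Q i'))) %% 2 ^ q_m2 Q) * 2 ^ r + y)%N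
      else a
  | None => a
  end.

Definition Qmat (N : nat) (Q : query N) (f : 'I_N -> R) : 'M[cpx R]_(2 ^ q_m Q) :=
  \matrix_(a, b) ((nat_of_ord a == qmap Q f b)%:R).

Record qalg0 (N : nat) := QAlg0 {
  a_q : query N;
  a_n : nat;
  a_U : nat -> 'M[cpx R]_(2 ^ q_m a_q);
  a_unitary : forall j, (j <= a_n)%N -> unitary (a_U j) }.

Fixpoint run (d : nat) (U : nat -> 'M[cpx R]_d) (Qf : 'M[cpx R]_d) (j : nat)
  : 'M[cpx R]_d :=
  match j with
  | 0 => U 0%N
  | j'.+1 => U j *m Qf *m run U Qf j'
  end.

Definition Af (N : nat) (A : qalg0 N) (f : 'I_N -> R) : 'M[cpx R]_(2 ^ q_m (a_q A)) :=
  run (a_U A) (Qmat (a_q A) f) (a_n A).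

Definition m_of (N : nat) (A : qalg0 N) : nat := q_m (a_q A).

(* quantum algorithm from F to R with k measurements; outcome tuples
   (x_0,...,x_(ell-1)) are encoded as sequences of naturals. *)
Record qalg (N : nat) := QAlg {
  k_of : nat;
  k_pos : (0 < k_of)%N;
  A_of : nat -> qalg0 N;
  b_of : nat -> seq nat -> nat;
  b_range : forall ell xs, (ell < k_of)%N -> size xs = ell ->
     (forall i, (i < ell)%N -> (nth 0 xs i < 2 ^ m_of (A_of i))%N) ->
     (b_of ell xs < 2 ^ m_of (A_of ell))%N;
  phi_of : seq nat -> R }.

Definition nq (N : nat) (A : qalg N) : nat := (\sum_(l < k_of A) a_n (A_of A l))%N.

Fixpoint sumtup (ms : seq nat) (g : seq nat -> R) : R :=
  match ms with
  | [::] => g [::]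
  | m :: ms' => \sum_(i < 2 ^ m) sumtup ms' (fun xs => g (nat_of_ord i :: xs))
  end.

Definition outprob (N : nat) (A : qalg N) (f : 'I_N -> R) (xs : seq nat) : R :=
  \prod_(l < k_of A)
     sqnorm (mxnat (Af (A_of A l) f) (nth 0 xs l) (b_of A l (take l xs))).

Definition err_prob (N : nat) (S : ('I_N -> R) -> R) (A : qalg N)
    (f : 'I_N -> R) (eps : R) : R :=
  sumtup [seq m_of (A_of A l) | l <- iota 0 (k_of A)]
    (fun xs => if eps < `|S f - phi_of A xs| then outprob A f xs else 0).

Definition err_f (N : nat) (S : ('I_N -> R) -> R) (A : qalg N) (f : 'I_N -> R)
  : \bar R :=
  ereal_inf [set eps%:E | eps in [set eps : R | err_prob S A f eps <= 4^-1]].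

Definition err_F (N : nat) (S : ('I_N -> R) -> R) (A : qalg N)
    (F : set ('I_N -> R)) : \bar R :=
  ereal_sup [set err_f S A f | f in F].

Definition eq_min (N : nat) (n : nat) (S : ('I_N -> R) -> R)
    (F : set ('I_N -> R)) : \bar R :=
  ereal_inf [set err_F S A F | A in [set A : qalg N | (nq A <= n)%N]].

Definition LpNorm (N : nat) (p : R) (f : 'I_N -> R) : R :=
  ((N%:R)^-1 * \sum_(i < N) `|f i| `^ p) `^ (p^-1).

Definition Bp (N : nat) (p : R) : set ('I_N -> R) :=
  [set f | LpNorm p f <= 1].

Definition SN (N : nat) (f : 'I_N -> R) : R := (N%:R)^-1 * \sum_(i < N) f i.

Definition log2 (x : R) : R := ln x / ln 2.

End QuantumModel.

(* Main.v *)
Require Import Defs.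
From HB Require Import structures.
From mathcomp Require Import all_boot all_order all_algebra.
From mathcomp Require Import all_classical all_reals.
From mathcomp Require Import ereal exp complex spectral ring lra zify.
Import Order.TTheory GRing.Theory Num.Theory.
Local Open Scope ring_scope.
Set Implicit Arguments. Unset Strict Implicit. Unset Printing Implicit Defensive.

(** The positive and negative parts of [f] are expanded in binary digits of
    weights [U / 2 ^ l] with [U = N ^ (1/p)]. By Markov's inequality the [l]-th
    digit is set at no more than [2 ^ (p l)] arguments, and the mean [a] of one
    binary digit can be estimated with [x] queries with mean square error
    [O(a / x^2 + 1 / x^4)]. For [2 ^ (p l)] up to a constant times [n^2 / N] this
    is precise enough to recover the mean exactly, since it is a multiple of
    [1 / N]; for the remaining digits the weighted errors sum geometrically to
    the rate. Budgets [x] decaying geometrically away from the critical level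
    keep the number of queries below [n], and Chebyshev's inequality with a
    union bound replaces any repetition. No search for the large values of [f]
    is made, so the bound holds even without the logarithmic factor.

    The estimate for one digit: with [psi] the uniform state and [G] the Grover
    iterate, the vectors [v_y = G^y psi] satisfy
    [v_(y+1) + v_(y-1) = 2 c v_y] with [c = 1 - 2 a]. In the superposition
    [Phi = sum_y w_y |y> v_y] one measures the adjacency operator [H] of a path
    acting on [y], divided by 2. The mean square deviation of the outcome from
    [c] is [|(H - c) Phi|^2], which by the recurrence only involves first and
    second differences of the window [w]. *)

(** * A smooth window *)

(** Squaring makes the parabola k (4h - k) vanish to second order at both ends, so second
    differences stay of order h^2 across the boundary of the support. Truncated subtraction gives 0
    for k >= 4h. *)
Definition hump (R : realType) (h k : nat) : R :=
  (k%:R * (4 * h - k)%:R) ^+ 2.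

Lemma hump_out (R : realType) (h k : nat) : (4 * h <= k)%N -> hump R h k = 0.
Proof. by rewrite /hump -subn_eq0 => /eqP ->; rewrite mulr0 expr0n. Qed.

Lemma humpE (R : realType) (h k : nat) : (k <= 4 * h)%N ->
  hump R h k = (k%:R * (4 * h%:R - k%:R)) ^+ 2.
Proof. by move=> hk; rewrite /hump natrB // natrM. Qed.

Lemma hump_diff (R : realType) (h k : nat) : (0 < h)%N ->
  (hump R h k.+1 - hump R h k) ^+ 2
    <= if (k < 4 * h + 1)%N then ((4 * h%:R) ^+ 3) ^+ 2 else 0.
Proof.
move=> h0; case: ifP => [hk|/negbT]; last first.
  rewrite -leqNgt => hk; rewrite !hump_out ?subrr ?expr0n //; lia.
have h1 : 1 <= h%:R :> R by rewrite ler1n.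
have [hk'|hk'] := ltnP k (4 * h); last first.
  rewrite !hump_out ?subrr ?expr0n /=; [exact: exprn_even_ge0|lia|lia].
rewrite (humpE R hk') (humpE R (ltnW hk')).
have k0 : 0 <= k%:R :> R by [].
have kh : k%:R + 1 <= 4 * h%:R :> R by rewrite -natrM natr1 ler_nat; lia.
rewrite -natr1.
set x := k%:R in k0 kh *; set y := 4 * h%:R in kh *.
have y4 : 4 <= y by rewrite /y; lra.
(* A difference of squares: in absolute value the first factor is at most y and the second at most
   y^2. *)
have -> : ((x + 1) * (y - (x + 1))) ^+ 2 - (x * (y - x)) ^+ 2
   = (y - 2 * x - 1) * (2 * x * (y - x) + (y - 2 * x - 1)) by ring.
rewrite -[leLHS]real_normK ?num_real // lerXn2r ?nnegrE //; first by apply: exprn_ge0; lra.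
rewrite normrM.
have s0 : 0 <= x * (y - x) by apply: mulr_ge0; lra.
have s1 : 4 * (x * (y - x)) <= y ^+ 2.
  have -> : y ^+ 2 = 4 * (x * (y - x)) + (y - 2 * x) ^+ 2 by ring.
  by rewrite lerDl sqr_ge0.
have -> : y ^+ 3 = y * y ^+ 2 by ring.
apply: ler_pM => //; first by rewrite ler_norml; lra.
rewrite ler_norml.
have : 4 * y <= y ^+ 2 by rewrite expr2 ler_wpM2r; lra.
have -> : 2 * x * (y - x) = 2 * (x * (y - x)) by ring.
lra.
Qed.

Lemma hump_diff2 (R : realType) (h k : nat) : (0 < h)%N ->
  (hump R h k.+1 - 2 * hump R h k + hump R h k.-1) ^+ 2
    <= if (k < 4 * h + 1)%N then (2 * (4 * h%:R) ^+ 2) ^+ 2 else 0.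
Proof.
move=> h0; case: ifP => [hk|/negbT]; last first.
  by rewrite -leqNgt => hk; rewrite !hump_out ?mulr0 ?subrr ?addr0 ?expr0n //; lia.
have h1 : 1 <= h%:R :> R by rewrite ler1n.
rewrite -[leLHS]real_normK ?num_real // lerXn2r ?nnegrE ?mulr_ge0 ?sqr_ge0 //.
(* At k = 0 the truncated predecessor is 0 again, which agrees with extension by zero; k = 4h is the
   other boundary case. *)
case: k hk => [|k hk] /=.
  have h1' : (1 <= 4 * h)%N by lia.
  move=> _; rewrite (humpE R h1') (humpE R (leq0n _)) !mul0r expr0n /=.
  rewrite mulr0 subr0 addr0 ger0_norm ?sqr_ge0 // mul1r.
  have : 0 <= h%:R * h%:R - h%:R :> R by rewrite subr_ge0 ler_peMr; lra.
  by rewrite !expr2; lra.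
have [hk'|hk'] := ltnP k.+1 (4 * h); last first.
  have -> : k = (4 * h - 1)%N by lia.
  have -> : ((4 * h - 1).+1 = 4 * h)%N by lia.
  rewrite !(@hump_out _ _ (4 * h)) // ?(@hump_out _ _ (4 * h).+1) // mulr0 subr0 add0r.
  have h1' : (4 * h - 1 <= 4 * h)%N by lia.
  rewrite (humpE R h1') natrB ?natrM; last by lia.
  have -> : 4 * h%:R - (4 * h%:R - 1) = 1 :> R by ring.
  rewrite mulr1 ger0_norm ?sqr_ge0 //.
  have : 0 <= h%:R * h%:R - h%:R :> R by rewrite subr_ge0 ler_peMr; lra.
  by rewrite !expr2; lra.
rewrite (humpE R hk') (humpE R (ltnW hk')) (humpE R (ltnW (ltnW hk'))).
have k0 : 0 <= k%:R :> R by [].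
have kh : k%:R + 2 <= 4 * h%:R :> R by rewrite -natrM -natrD ler_nat; lia.
have e1 : k.+1%:R = k%:R + 1 :> R by rewrite natr1.
have e2 : k.+2%:R = k%:R + 1 + 1 :> R by rewrite !natr1.
rewrite e2 e1.
set x := k%:R in k0 kh *; set y := 4 * h%:R in kh *.
have y4 : 4 <= y by rewrite /y; lra.
have -> : ((x + 1 + 1) * (y - (x + 1 + 1))) ^+ 2 - 2 * ((x + 1) * (y - (x + 1))) ^+ 2
  + (x * (y - x)) ^+ 2 = 3 * (y - 2 * (x + 1)) ^+ 2 + 2 - y ^+ 2 by ring.
have s1 : (y - 2 * (x + 1)) ^+ 2 <= (y - 2) ^+ 2.
  rewrite -[leLHS]real_normK ?num_real // lerXn2r ?nnegrE //; first by lra.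
  by rewrite ler_norml; lra.
have s0 := sqr_ge0 (y - 2 * (x + 1)).
set e := (y - _) ^+ 2 in s0 s1 *.
have s2 : (y - 2) ^+ 2 = y ^+ 2 - 4 * y + 4 by ring.
rewrite s2 in s1.
have s3 : 4 * y <= y ^+ 2 by rewrite expr2 ler_wpM2r; lra.
by rewrite ler_norml; lra.
Qed.

(** On the middle half h <= k < 3h both k and 4h - k are at least h. *)
Lemma hump_mass (R : realType) (h Y : nat) : (0 < h)%N -> (4 * h < Y)%N ->
  2 * h%:R * (h%:R ^+ 4) ^+ 2 <= \sum_(k < Y) hump R h k ^+ 2.
Proof.
move=> h0 hY; rewrite -(big_mkord xpredT (fun k => hump R h k ^+ 2)).
rewrite (@big_cat_nat _ _ _ h) /=; [|by lia|by lia].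
rewrite (@big_cat_nat _ _ _ (3 * h) h) /=; [|by lia|by lia].
rewrite -[leLHS]addr0 -[leLHS]add0r; apply: lerD; first by apply: sumr_ge0 => ? _; apply: sqr_ge0.
apply: lerD; last by apply: sumr_ge0 => ? _; apply: sqr_ge0.
have -> : 2 * h%:R * (h%:R ^+ 4) ^+ 2 = \sum_(h <= k < 3 * h) (h%:R ^+ 4) ^+ 2 :> R.
  rewrite sumr_const_nat -[RHS]mulr_natl; congr (_ * _).
  by rewrite -natrM; congr (_%:R); lia.
rewrite !big_nat; apply: ler_sum => k /andP[hk kh].
have kh' : (k <= 4 * h)%N by lia.
rewrite (humpE R kh').
have h1 : 1 <= h%:R :> R by rewrite ler1n.
have k1 : h%:R <= k%:R :> R by rewrite ler_nat.
have k3 : k%:R <= 3 * h%:R :> R by rewrite -natrM ler_nat ltnW.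
have h00 : 0 <= h%:R :> R by [].
have -> : h%:R ^+ 4 = (h%:R * h%:R) ^+ 2 :> R by ring.
have p0 : 0 <= h%:R * h%:R :> R by apply: mulr_ge0.
have p1 : h%:R * h%:R <= k%:R * (4 * h%:R - k%:R) :> R by apply: ler_pM => //; lra.
have p2 := le_trans p0 p1.
rewrite !lerXn2r ?nnegrE ?exprn_ge0 //.
Qed.

(** The normalised hump: its mass is at least h^9, while its differences live on at most 4h + 1 <=
    5h indices with squares of order h^6 and h^4. *)
Lemma window (R : realType) : exists2 C : R, 0 < C &
  forall h Y : nat, (0 < h)%N -> (4 * h < Y)%N ->
  exists w : nat -> R,
    [/\ w 0%N = 0, forall k, (4 * h <= k)%N -> w k = 0,
        \sum_(k < Y) w k ^+ 2 = 1,
        \sum_(k < Y) (w k.+1 - w k) ^+ 2 <= C / h%:R ^+ 2 &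
        \sum_(k < Y) (w k.+1 - 2 * w k + w k.-1) ^+ 2 <= C / h%:R ^+ 4].
Proof.
exists (4 ^+ 6 * 5) => [|h Y h0 hY]; first by apply: mulr_gt0 => //; apply: exprn_gt0.
have hp : 0 < h%:R :> R by rewrite ltr0n.
have h1 : 1 <= h%:R :> R by rewrite ler1n.
set S := \sum_(k < Y) hump R h k ^+ 2.
have S1 : h%:R ^+ 9 <= S.
  apply: le_trans (hump_mass R h0 hY).
  have -> : 2 * h%:R * (h%:R ^+ 4) ^+ 2 = h%:R ^+ 9 + h%:R ^+ 9 :> R by ring.
  by rewrite lerDl exprn_ge0 // ltW.
have S0 : 0 < S by apply: lt_le_trans S1; rewrite exprn_gt0.
have Sn : (Num.sqrt S)^-1 ^+ 2 = S^-1 by rewrite exprVn sqr_sqrtr // ltW.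
have sumB (f : nat -> R) (B : R) : 0 <= B ->
    (forall k, f k <= if (k < 4 * h + 1)%N then B else 0) ->
    \sum_(k < Y) f k <= 5 * h%:R * B.
  move=> B0 hf; apply: (@le_trans _ _ (\sum_(k < Y) if (k < 4 * h + 1)%N then B else 0)).
    by apply: ler_sum => k _.
  rewrite -(big_mkord xpredT (fun k => if (k < 4 * h + 1)%N then B else 0)).
  rewrite (@big_cat_nat _ _ _ (4 * h + 1)) /=; [|by lia|by lia].
  rewrite [X in _ + X]big_nat_cond [X in _ + X]big1 => [|k]; last first.
    by rewrite andbT leqNgt => /andP[/negbTE ->].
  rewrite addr0 big_nat (eq_bigr (fun=> B)) => [|k /andP[_ ->] //].
  rewrite -big_nat sumr_const_nat subn0 -[leLHS]mulr_natl ler_wpM2r //.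
  by rewrite natrD natrM; lra.
exists (fun k => (Num.sqrt S)^-1 * hump R h k); split.
- by rewrite /hump mul0r expr0n mulr0.
- by move=> k hk; rewrite hump_out ?mulr0.
- under eq_bigr do rewrite exprMn Sn.
  by rewrite -mulr_sumr mulVf // gt_eqF.
- under eq_bigr do rewrite -mulrBr exprMn Sn.
  rewrite -mulr_sumr mulrC ler_pdivrMr //.
  apply: (le_trans (sumB (fun k => (hump R h k.+1 - hump R h k) ^+ 2) _ _ (fun k => hump_diff R k h0))).
    exact: sqr_ge0.
  have -> : 5 * h%:R * ((4 * h%:R) ^+ 3) ^+ 2 = 4 ^+ 6 * 5 / h%:R ^+ 2 * h%:R ^+ 9 :> R.
    by field; rewrite gt_eqF.
  by rewrite ler_pM2l // !mulr_gt0 ?invr_gt0 ?exprn_gt0.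
- under eq_bigr do rewrite [2 * _]mulrCA -mulrBr -mulrDr exprMn Sn.
  rewrite -mulr_sumr mulrC ler_pdivrMr //.
  apply: (le_trans (sumB (fun k => (hump R h k.+1 - 2 * hump R h k + hump R h k.-1) ^+ 2) _ _ (fun k => hump_diff2 R k h0))).
    exact: sqr_ge0.
  have -> : 5 * h%:R * (2 * (4 * h%:R) ^+ 2) ^+ 2 = 4^-1 * (4 ^+ 6 * 5 / h%:R ^+ 4 * h%:R ^+ 9) :> R.
    by field; rewrite gt_eqF.
  have K0 : 0 < 4 ^+ 6 * 5 / h%:R ^+ 4 :> R by rewrite !mulr_gt0 ?invr_gt0 ?exprn_gt0.
  have K1 : 4 ^+ 6 * 5 / h%:R ^+ 4 * h%:R ^+ 9 <= 4 ^+ 6 * 5 / h%:R ^+ 4 * S by rewrite ler_pM2l.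
  have K2 : 0 <= 4 ^+ 6 * 5 / h%:R ^+ 4 * h%:R ^+ 9 :> R by rewrite mulr_ge0 ?exprn_ge0 ?ltW.
  by move: K1 K2; lra.
Qed.

(** * Basis states and the query matrix *)

Section Packing.
Variables (m1 w : nat).

(** The registers: argument index, one-qubit answer (the ancilla), and a counter of [w] qubits that
    selects the number of Grover iterations. *)
Definition cell := ('I_(2 ^ m1) * bool * 'I_(2 ^ w))%type.

Lemma pack_proof (t : cell) :
  (t.1.1 * 2 ^ (1 + w) + t.1.2 * 2 ^ w + t.2 < 2 ^ (m1 + 1 + w))%N.
Proof.
case: t => -[[i hi] x] [y hy] /=.
have -> : (2 ^ (m1 + 1 + w) = 2 ^ m1 * (2 * 2 ^ w))%N by rewrite -addnA expnD add1n expnS.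
have -> : (2 ^ (1 + w) = 2 * 2 ^ w)%N by rewrite add1n expnS.
have : (i.+1 * (2 * 2 ^ w) <= 2 ^ m1 * (2 * 2 ^ w))%N by rewrite leq_mul2r hi orbT.
by case: x => /=; lia.
Qed.

Definition pack (t : cell) : 'I_(2 ^ (m1 + 1 + w)) := Ordinal (pack_proof t).

Lemma unpack_proof1 (a : 'I_(2 ^ (m1 + 1 + w))) : (a %/ 2 ^ (1 + w) < 2 ^ m1)%N.
Proof. by rewrite ltn_divLR ?expn_gt0 // -expnD addnA. Qed.

Lemma unpack_proof2 (a : 'I_(2 ^ (m1 + 1 + w))) : (a %% 2 ^ w < 2 ^ w)%N.
Proof. by rewrite ltn_mod expn_gt0. Qed.

Definition unpack (a : 'I_(2 ^ (m1 + 1 + w))) : cell :=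
  (Ordinal (unpack_proof1 a), odd (a %/ 2 ^ w), Ordinal (unpack_proof2 a)).

Lemma unpackK : cancel unpack pack.
Proof.
move=> a; apply: val_inj => /=.
have -> : (2 ^ (1 + w) = 2 ^ w * 2)%N by rewrite add1n expnS mulnC.
rewrite divnMA -modn2 mulnCA mulnC -mulnDl -divn_eq.
by rewrite -divn_eq.
Qed.

Lemma packK : cancel pack unpack.
Proof.
move=> [[[i hi] x] [y hy]]; rewrite /unpack /pack /=.
have w0 : (0 < 2 ^ w)%N by rewrite expn_gt0.
have x2 : (x < 2)%N by case: x.
have e : (i * 2 ^ (1 + w) + x * 2 ^ w + y = (i * 2 + x) * 2 ^ w + y)%N.
  by rewrite add1n expnS mulnDl mulnA.
congr (_, _, _).
- apply: val_inj => /=; rewrite e add1n expnS [(2 * 2 ^ w)%N]mulnC divnMA.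
  by rewrite divnMDl // [(y %/ _)%N]divn_small // addn0 divnMDl // divn_small // addn0.
- by rewrite e divnMDl // divn_small // addn0 oddD oddM andbF /= oddb.
- by apply: val_inj => /=; rewrite e modnMDl modn_small.
Qed.

End Packing.

Section KernelMatrices.
Variables (R : realType) (m1 w : nat).
Let d := (2 ^ (m1 + 1 + w))%N.
Let T := cell m1 w.

(** Kernels on register triples turn matrix products into sums over registers, away from the binary
    encoding of basis states. *)
Definition kmx (K : T -> T -> R) : 'M[R]_d :=
  \matrix_(a, b) K (unpack a) (unpack b).

Definition kcol (F : T -> R) : 'cV[R]_d := \col_a F (unpack a).

Lemma sum_unpack (F : T -> R) : \sum_(a < d) F (unpack a) = \sum_t F t.
Proof.
rewrite [RHS](reindex (@unpack m1 w)) //.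
by exists (@pack m1 w) => t _; rewrite ?packK ?unpackK.
Qed.

Lemma sum_cell (F : T -> R) :
  \sum_t F t = \sum_(i < 2 ^ m1) \sum_(x : bool) \sum_(y < 2 ^ w) F (i, x, y).
Proof.
rewrite pair_bigA /= pair_bigA /=.
by apply: eq_bigr => -[[]].
Qed.

Lemma kmx_kcol (K : T -> T -> R) (F : T -> R) :
  kmx K *m kcol F = kcol (fun t => \sum_t' K t t' * F t').
Proof.
apply/matrixP => a b; rewrite !mxE -(sum_unpack (fun t => K (unpack a) t * F t)).
by apply: eq_bigr => c _; rewrite !mxE.
Qed.

Lemma kmx_mul (K L : T -> T -> R) :
  kmx K *m kmx L = kmx (fun t t' => \sum_s K t s * L s t').
Proof.
apply/matrixP => a b.
rewrite !mxE -(sum_unpack (fun t => K (unpack a) t * L t (unpack b))).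
by apply: eq_bigr => c _; rewrite !mxE.
Qed.

Lemma kmx_id : kmx (fun t t' => (t == t')%:R) = 1%:M.
Proof.
by apply/matrixP => a b; rewrite !mxE (inj_eq (can_inj (@unpackK m1 w))).
Qed.

End KernelMatrices.

Section Query.
Variables (R : realType) (N : nat) (N0 : (0 < N)%N) (g : R -> bool).
Variables (m1 w : nat) (m10 : (0 < m1)%N) (hN : (N <= 2 ^ m1)%N).

Let Z := [set i : 'I_(2 ^ m1) | (i < N)%N]%SET.

Lemma bitquery_Z : Z != finset.set0.
Proof.
by apply/set0Pn; exists (Ordinal (leq_trans N0 hN)); rewrite inE.
Qed.

Definition bitquery : query R N :=
  @Query R N (m1 + 1 + w) m1 1 Z (insubd (Ordinal N0))
    (fun r => @inord 1 (g r)) (leq_trans m10 (leq_trans (leq_addr 1 m1) (leq_addr w _)))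
    m10 isT (leq_addr w _) bitquery_Z.

(** Indices from N to 2^m1 - 1 lie outside [Z] and count as unmarked. *)
Definition marked (f : 'I_N -> R) (i : 'I_(2 ^ m1)) : bool :=
  (i < N)%N && g (f (insubd (Ordinal N0) (i : nat))).

Definition flip (f : 'I_N -> R) (t : cell m1 w) : cell m1 w :=
  (t.1.1, t.1.2 (+) marked f t.1.1, t.2).

Lemma flipK f : involutive (flip f).
Proof. by move=> [[i x] y]; rewrite /flip /= addbK. Qed.

Lemma qmapE f (b : 'I_(2 ^ (m1 + 1 + w))) :
  qmap bitquery f b = pack (flip f (unpack b)).
Proof.
rewrite /qmap /= /flip /marked /=.
have -> : (m1 + 1 + w - m1 - 1 = w)%N by lia.
have -> : (m1 + 1 + w - m1 = 1 + w)%N by lia.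
rewrite insubT ?unpack_proof1 // => h /=.
rewrite inE /=.
case: ifP => hZ /=; last first.
  by rewrite addbF -[LHS]/(val b) -{1}(unpackK b).
rewrite (@inordK 1); last by case: (g _).
by rewrite expn1 !modn2 oddD !oddb.
Qed.

Lemma Qmat_bitquery f :
  Qmat bitquery f
  = map_mx (real_complex R) (kmx (fun t t' => (t == flip f t')%:R)).
Proof.
apply/matrixP => a b; rewrite !mxE qmapE rmorph_nat; congr (_%:R).
by rewrite -(inj_eq (can_inj (@packK m1 w))) unpackK.
Qed.

Lemma flip_kcol f (F : cell m1 w -> R) :
  kmx (fun t t' => (t == flip f t')%:R) *m kcol F = kcol (F \o flip f).
Proof.
rewrite kmx_kcol; congr kcol; apply/boolp.funext => t /=.
rewrite (bigD1 (flip f t)) //= flipK eqxx mul1r big1 ?addr0 // => s hs.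
have /negbTE -> : t != flip f s by apply: contraNneq hs => ->; rewrite flipK.
by rewrite mul0r.
Qed.

End Query.

(** * Orthogonal completion and measurement of a symmetric matrix *)

Lemma unitary_sqnorm (R : realType) (d : nat) (U : 'M[cpx R]_d) (u : 'cV[cpx R]_d) :
  unitary U -> \sum_a sqnorm ((U *m u) a 0) = \sum_a sqnorm (u a 0).
Proof.
have key (z : 'cV[cpx R]_d) : (\sum_a sqnorm (z a 0))%:C%C
    = ((map_mx (@conjc R) z)^T *m z) 0 0.
  rewrite mxE rmorph_sum; apply: eq_bigr => a _; rewrite !mxE.
  case: (z a 0) => x y; apply/eqP; rewrite /sqnorm eq_complex /=.
  by apply/andP; split; apply/eqP; ring.
rewrite /unitary => UV.
have UV' : (map_mx (@conjc R) U)^T *m U = 1%:M by exact: mulmx1C.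
have : (\sum_a sqnorm ((U *m u) a 0))%:C%C = (\sum_a sqnorm (u a 0))%:C%C.
  by rewrite !key map_mxM trmx_mul mulmxA -(mulmxA _ _ U) UV' mulmx1.
by move=> /complexI.
Qed.

Lemma unitary_real (R : realType) (d : nat) (E : 'M[R]_d) :
  E *m E^T = 1%:M -> unitary (map_mx (real_complex R) E).
Proof.
move=> EE; rewrite /unitary.
have -> : map_mx (@conjc R) (map_mx (real_complex R) E) = map_mx (real_complex R) E.
  by apply/matrixP => i j; rewrite !mxE conjc_real.
by rewrite map_trmx -map_mxM EE map_mx1.
Qed.

Lemma unitaryM (R : realType) (d : nat) (U V : 'M[cpx R]_d) :
  unitary U -> unitary V -> unitary (U *m V).
Proof.
rewrite /unitary => UU VV.
by rewrite map_mxM trmx_mul mulmxA -(mulmxA U) VV mulmx1.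
Qed.

(** The reflection 1 - 2 u u^T / |u|^2 with u = v - e exchanges v and the basis vector e. It serves
    to prepare the initial state. *)
Lemma householder (R : realType) (d : nat) (v : 'cV[R]_d) (b : 'I_d) :
  v^T *m v = 1%:M ->
  exists2 E : 'M[R]_d, E *m E^T = 1%:M & E *m delta_mx b 0 = v.
Proof.
move=> vv; set e : 'cV[R]_d := delta_mx b 0.
have ee : e^T *m e = 1%:M.
  by rewrite /e trmx_delta mul_delta_mx; apply/matrixP => i j; rewrite !mxE !ord1.
pose u := v - e.
have scal (z : 'M[R]_1) : z = (z 0 0)%:M by apply/matrixP => i j; rewrite !ord1 !mxE mulr1n.
have uT : u^T = v^T - e^T by apply/matrixP => i j; rewrite !mxE.
pose s := (u^T *m u) 0 0; pose t := (e^T *m v) 0 0.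
have uu : u^T *m u = s%:M by exact: scal.
have ev : e^T *m v = t%:M by exact: scal.
have ve : v^T *m e = t%:M by rewrite -[LHS]trmxK trmx_mul trmxK ev tr_scalar_mx.
have st : s = 2 - 2 * t.
  have : s%:M = (2 - 2 * t)%:M :> 'M[R]_1.
    rewrite -uu uT mulmxBl !mulmxBr vv ee ev ve.
    by apply/matrixP => i j; rewrite !ord1 !mxE /= !mulr1n; ring.
  by move/matrixP/(_ 0 0); rewrite !mxE !mulr1n.
(* Here s = |u|^2; if it vanishes, v is already the basis vector and the identity serves. *)
have [s0|s0] := eqVneq s 0.
  have u0 : u = 0.
    apply/matrixP => i j; rewrite ord1 [RHS]mxE.
    have : \sum_i (u i 0) ^+ 2 = 0.
      transitivity s => //; rewrite /s mxE.
      by apply: eq_bigr => k _; rewrite !mxE expr2.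
    move/eqP; rewrite psumr_eq0 => [/allP/(_ i)|k _]; last exact: sqr_ge0.
    by rewrite mem_index_enum sqrf_eq0 => /(_ isT)/eqP.
  exists 1%:M; first by rewrite mul1mx trmx1.
  by rewrite mul1mx; apply/esym/eqP; rewrite -subr_eq0 -/e -/u u0.
pose k := 2 / s.
have Esym : (1%:M - k *: (u *m u^T))^T = 1%:M - k *: (u *m u^T).
  by rewrite linearB /= linearZ /= trmx_mul trmxK trmx1.
have eu : u^T *m e = (t - 1)%:M.
  by rewrite uT mulmxBl ve ee -raddfB.
exists (1%:M - k *: (u *m u^T)).
  rewrite Esym mulmxBl mul1mx mulmxBr mulmx1 -!scalemxAl -!scalemxAr.
  rewrite mulmxA -(mulmxA u) uu mul_mx_scalar -scalemxAl !scalerA.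
  have -> : k * (k * s) = k + k by rewrite /k; field.
  by rewrite scalerDl; apply/eqP; rewrite opprB !addrA subrK -addrA subrr addr0.
rewrite mulmxBl mul1mx -scalemxAl -mulmxA eu mul_mx_scalar scalerA.
(* Since s = 2 - 2 t, the product u^T e = t - 1 equals - s / 2, so the reflection adds exactly u to
   e. *)
have -> : k * (t - 1) = -1.
  have -> : t - 1 = - s / 2 by rewrite st; field.
  by rewrite /k; field.
by rewrite scaleN1r opprK /u addrC subrK.
Qed.

(** Measurement in an orthonormal eigenbasis of H: on the eigenbasis coordinates H - c is diagonal.
    Only real parts of the eigenvalues are kept; an imaginary part would add a nonnegative term on
    the right, whence the inequality. *)
Lemma measure_symmetric (R : realType) (d : nat) (H : 'M[R]_d) : H^T = H ->
  exists (V : 'M[cpx R]_d) (lam : 'I_d -> R), unitary V /\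
    forall (S : 'cV[R]_d) (c : R),
      \sum_a sqnorm ((V *m map_mx (real_complex R) S) a 0) * (lam a - c) ^+ 2
        <= \sum_a ((H *m S - c *: S) a 0) ^+ 2.
Proof.
move=> HT; pose A := map_mx (real_complex R) H.
have An : A \is normalmx.
  apply: symmetric_normalmx.
    by apply/is_hermitianmxP; rewrite expr0 scale1r map_mx_id // map_trmx HT.
  apply/mxOverP => i j; rewrite mxE; apply/CrealP; exact: conjc_real.
have [V [D [/unitarymxP VV Vu AE]]] : exists V D,
    [/\ V \is unitarymx, V \in unitmx & A = invmx V *m diag_mx D *m V].
  exists (spectralmx A), (spectral_diag A).
  split; [exact: spectral_unitarymx|exact: spectral_unit|exact/orthomx_spectralP].
have VA : diag_mx D *m V = V *m A.
  by rewrite AE !mulmxA mulmxV // mul1mx.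
have {}VV : unitary V by rewrite /unitary map_trmx.
exists V, (fun a => complex.Re (D 0 a)); split=> // S c.
pose z := map_mx (real_complex R) (H *m S - c *: S).
have -> : \sum_a ((H *m S - c *: S) a 0) ^+ 2 = \sum_a sqnorm (z a 0).
  by apply: eq_bigr => a _; rewrite [z a 0]mxE /sqnorm /= expr0n addr0.
rewrite -(unitary_sqnorm z VV); apply: ler_sum => a _.
have -> : (V *m z) a 0 = (D 0 a - c%:C%C) * (V *m map_mx (real_complex R) S) a 0.
  rewrite /z map_mxB map_mxZ map_mxM mulmxBr mulmxA -/A -VA -scalemxAr.
  by rewrite -mulmxA mul_diag_mx !mxE mulrBl.
case: (D 0 a) => x y; case: (_ a 0) => u v; simpc; rewrite /sqnorm /=.
have -> : ((x - c) * u - y * v) ^+ 2 + ((x - c) * v + y * u) ^+ 2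
  = (u ^+ 2 + v ^+ 2) * (x - c) ^+ 2 + (u ^+ 2 + v ^+ 2) * y ^+ 2 by ring.
by rewrite lerDl mulr_ge0 ?addr_ge0 ?sqr_ge0.
Qed.

(** * Controlled Grover iteration *)

Section Chebyshev.
Variables (R : realType) (c : R).

(** A pair p stands for the vector p.1 psi + p.2 O psi, where O is the oracle sign and c the inner
    product of psi and O psi. The step is the Grover iterate G in these coordinates: (0, 1) is O
    psi, and [cheb k.+1] stands for G^k psi. The entries are, up to sign, Chebyshev polynomials of
    the second kind in c. *)
Definition cheb_step (p : R * R) : R * R := (2 * c * p.1 + p.2, - p.1).
Definition cheb (k : nat) : R * R := iter k cheb_step (0, 1).

(** The squared norm of the vector represented by p; its invariance under [cheb_step] reflects the
    orthogonality of G. *)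
Definition cheb_form (p : R * R) : R := p.1 ^+ 2 + p.2 ^+ 2 + 2 * c * (p.1 * p.2).

Definition cheb_diff (k : nat) : R * R :=
  ((cheb k.+2).1 - (cheb k).1, (cheb k.+2).2 - (cheb k).2).

Lemma cheb_formS p : cheb_form (cheb_step p) = cheb_form p.
Proof. by rewrite /cheb_form /=; ring. Qed.

Lemma cheb_form1 k : cheb_form (cheb k) = 1.
Proof.
elim: k => [|k IH]; last by rewrite /cheb iterS cheb_formS.
by rewrite /cheb_form /=; ring.
Qed.

(** The differences evolve by the same step, so their norm is that at k = 0. It is small when c is
    close to 1, that is, for a small mean. *)
Lemma cheb_form_diff k : cheb_form (cheb_diff k) = 4 * (1 - c ^+ 2).
Proof.
elim: k => [|k <-]; first by rewrite /cheb_form /cheb_diff /=; ring.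
rewrite -[RHS]cheb_formS; congr cheb_form.
by rewrite /cheb_diff /cheb_step /=; congr (_, _); ring.
Qed.

Lemma cheb_rec1 k : (cheb k.+2).1 = 2 * c * (cheb k.+1).1 - (cheb k).1.
Proof. by rewrite /=; ring. Qed.

Lemma cheb_rec2 k : (cheb k.+2).2 = 2 * c * (cheb k.+1).2 - (cheb k).2.
Proof. by rewrite /=; ring. Qed.

End Chebyshev.
Arguments cheb : simpl never.

Section Evolution.
Variables (R : realType) (N : nat) (N0 : (0 < N)%N) (g : R -> bool).
Variables (m1 w : nat) (hN : (N <= 2 ^ m1)%N).
Let T := cell m1 w.
Let I := 'I_(2 ^ m1).

Definition psi (i : I) : R := if (i < N)%N then (Num.sqrt N%:R)^-1 else 0.

Lemma psi2 i : psi i ^+ 2 = if (i < N)%N then N%:R^-1 else 0.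
Proof.
rewrite /psi; case: ifP => _; last by rewrite expr0n.
by rewrite exprVn sqr_sqrtr.
Qed.

Lemma sum_psi2 (F : nat -> R) :
  \sum_i psi i ^+ 2 * F i = N%:R^-1 * \sum_(i < N) F i.
Proof.
rewrite (big_ord_widen _ F hN) [X in _ * X]big_mkcond mulr_sumr; apply: eq_bigr => i _.
by rewrite psi2; case: ifP; rewrite ?mul0r ?mulr0.
Qed.

Lemma psi_norm : \sum_i psi i ^+ 2 = 1.
Proof.
transitivity (\sum_i psi i ^+ 2 * 1); first by under [RHS]eq_bigr do rewrite mulr1.
rewrite (sum_psi2 (fun=> 1)) sumr_const card_ord mulVf //.
by rewrite pnatr_eq0 -lt0n.
Qed.

Variable f : 'I_N -> R.

Definition sg (i : I) : R := if marked N0 g f i then -1 else 1.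
Definition bitmean : R := SN (fun i => (g (f i))%:R).
Definition cosf : R := 1 - 2 * bitmean.

Lemma sg2 i : sg i * sg i = 1.
Proof. by rewrite /sg; case: ifP; rewrite ?mulrNN mulr1. Qed.

Lemma psi_sg : \sum_i psi i ^+ 2 * sg i = cosf.
Proof.
pose F (k : nat) : R := if (k < N)%N && g (f (insubd (Ordinal N0) k)) then -1 else 1.
rewrite (sum_psi2 F) /cosf /bitmean /SN.
have -> : \sum_(i < N) F i = \sum_(i < N) (1 - 2 * (g (f i))%:R).
  apply: eq_bigr => i _; rewrite /F ltn_ord /=.
  have -> : insubd (Ordinal N0) (i : nat) = i by apply: val_inj; rewrite val_insubd ltn_ord.
  by case: (g (f i)); rewrite ?mulr1 ?mulr0 ?subr0 //; ring.
rewrite sumrB sumr_const card_ord -mulr_sumr mulrBr mulVf ?pnatr_eq0 -?lt0n //.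
by rewrite mulrCA.
Qed.

Definition ev (p : R * R) (i : I) : R := psi i * (p.1 + p.2 * sg i).

Lemma ev_form p : \sum_i ev p i ^+ 2 = cheb_form cosf p.
Proof.
transitivity (\sum_i ((p.1 ^+ 2 + p.2 ^+ 2) * psi i ^+ 2
    + 2 * (p.1 * p.2) * (psi i ^+ 2 * sg i))).
  apply: eq_bigr => i _; rewrite /ev.
  have -> : (psi i * (p.1 + p.2 * sg i)) ^+ 2 =
    psi i ^+ 2 * (p.1 ^+ 2 + p.2 ^+ 2 * (sg i * sg i) + 2 * p.1 * p.2 * sg i) by ring.
  by rewrite sg2; ring.
rewrite big_split /= -!mulr_sumr psi_norm psi_sg /cheb_form; ring.
Qed.

(** The plane spanned by psi and O psi is invariant under G, because the inner product of psi with O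
    applied to [ev p] is p.1 c + p.2. *)
Lemma ev_step p i :
  2 * psi i * (\sum_k psi k * (sg k * ev p k)) - sg i * ev p i
  = ev (cheb_step cosf p) i.
Proof.
have -> : \sum_k psi k * (sg k * ev p k) = p.1 * cosf + p.2.
  transitivity (\sum_k (p.1 * (psi k ^+ 2 * sg k) + p.2 * psi k ^+ 2)).
    apply: eq_bigr => k _; rewrite /ev.
    have -> : psi k * (sg k * (psi k * (p.1 + p.2 * sg k)))
      = psi k ^+ 2 * (p.1 * sg k + p.2 * (sg k * sg k)) by ring.
    by rewrite sg2; ring.
  by rewrite big_split /= -!mulr_sumr psi_sg psi_norm mulr1.
rewrite /ev /cheb_step /=.
have -> : sg i * (psi i * (p.1 + p.2 * sg i))
   = psi i * (p.1 * sg i + p.2 * (sg i * sg i)) by ring.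
by rewrite sg2; ring.
Qed.

(* Controlled Grover diffusion: it acts on the branches that are still active
   and takes branch [j] out by returning its ancilla from |-> to |+>. *)
Definition diffusion (j : nat) (t t' : T) : R :=
  ((t.1.2 == t'.1.2) && (t.2 == t'.2))%:R *
  (if (j <= t.2)%N then
     (2 * psi t.1.1 * psi t'.1.1 - (t.1.1 == t'.1.1)%:R)
     * (if t.1.2 && (t.2 == j :> nat) then -1 else 1)
   else (t.1.1 == t'.1.1)%:R).

Lemma sum_diag (F : T -> R) (x : bool) (y : 'I_(2 ^ w)) :
  \sum_t (((x == t.1.2) && (y == t.2))%:R * F t) = \sum_i F (i, x, y).
Proof.
rewrite sum_cell; apply: eq_bigr => i _.
rewrite (bigD1 x) //= [X in _ + X]big1 => [|x' /negbTE xx]; last first.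
  by rewrite big1 // => y' _; rewrite eq_sym xx mul0r.
rewrite addr0 (bigD1 y) //= [X in _ + X]big1 => [|y' /negbTE yy]; last first.
  by rewrite [y == _]eq_sym yy andbF mul0r.
by rewrite !eqxx mul1r addr0.
Qed.

Lemma sum_delta (F : I -> R) i : \sum_k (i == k)%:R * F k = F i.
Proof.
rewrite (bigD1 i) //= big1 => [|k /negbTE ki]; last by rewrite eq_sym ki mul0r.
by rewrite eqxx mul1r addr0.
Qed.

(** The matrix is symmetric and an involution: on active branches it is the reflection 2 psi psi^T -
    1 up to a sign. *)
Lemma diffusion_orthogonal j :
  kmx (diffusion j) *m (kmx (diffusion j))^T = 1%:M.
Proof.
have -> : (kmx (diffusion j))^T = kmx (diffusion j).
  apply/matrixP => a b; rewrite !mxE /diffusion.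
  case: (unpack a) => [[i x] y]; case: (unpack b) => [[i' x'] y'] /=.
  rewrite [x' == x]eq_sym [y' == y]eq_sym [i' == i]eq_sym.
  case: eqP => [->|_] /=; last by rewrite !mul0r.
  case: eqP => [->|_] /=; last by rewrite !mul0r.
  by case: ifP => // _; congr (_ * (_ * _)); ring.
rewrite kmx_mul -kmx_id; congr kmx.
apply/boolp.funext => -[[i x] y]; apply/boolp.funext => -[[i' x'] y'].
rewrite {1}/diffusion /=.
under eq_bigr do rewrite -mulrA.
rewrite (sum_diag (fun s => _ * diffusion j s (i', x', y'))) /diffusion /=.
have -> : ((i, x, y) == (i', x', y') :> T) = (i == i') && ((x == x') && (y == y')).
  by rewrite -!pair_eqE /= andbA.
set b := (x == x') && (y == y').
have [hj|hj] /= := leqP j y; last first.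
  rewrite (sum_delta (fun k => b%:R * (k == i')%:R)).
  by case: b; rewrite ?andbF ?andbT ?mul1r ?mul0r.
set s := (if _ then -1 else 1 : R).
have s2 : s * s = 1 by rewrite /s; case: ifP; rewrite ?mulrNN mulr1.
transitivity (b%:R * (s * s) *
  \sum_k (2 * psi i * psi k - (i == k)%:R) * (2 * psi k * psi i' - (k == i')%:R)).
  by rewrite mulr_sumr; apply: eq_bigr => k _; ring.
rewrite s2 mulr1.
suff -> : \sum_k (2 * psi i * psi k - (i == k)%:R) * (2 * psi k * psi i' - (k == i')%:R)
   = (i == i')%:R :> R by case: b; rewrite ?andbF ?andbT ?mul1r ?mul0r.
transitivity (\sum_k (4 * psi i * psi i' * psi k ^+ 2
   - (i' == k)%:R * (2 * psi i * psi k)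
   - (i == k)%:R * (2 * psi k * psi i' - (k == i')%:R))).
  by apply: eq_bigr => k _; rewrite [i' == k]eq_sym; ring.
rewrite !sumrB -mulr_sumr psi_norm.
rewrite (sum_delta (fun k => 2 * psi i * psi k)).
rewrite (sum_delta (fun k => 2 * psi k * psi i' - (k == i')%:R)); ring.
Qed.

Variable win : nat -> R.

Definition sq2 : R := (Num.sqrt 2)^-1.
Lemma sq2E : sq2 ^+ 2 * 2 = 1.
Proof. by rewrite /sq2 exprVn sqr_sqrtr // mulVf. Qed.

(* Branch [y] of the counter has undergone [minn j y] Grover iterations, and
   its ancilla is |-> exactly while it is active. *)
Definition gstate (j : nat) (t : T) : R :=
  sq2 * win t.2 * ev (cheb cosf (minn j t.2).+1) t.1.1
  * (if t.1.2 && (j < t.2)%N then -1 else 1).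

(** Phase kickback: on an active branch the ancilla is |->, so the query multiplies by [sg] and the
    diffusion completes a Grover iteration. On a retired branch the ancilla is |+>, which the query
    fixes. *)
Lemma gstate_step j :
  kmx (diffusion j.+1) *m
    (kmx (fun t t' => (t == flip N0 g f t')%:R) *m kcol (gstate j))
  = kcol (gstate j.+1).
Proof.
rewrite flip_kcol kmx_kcol; congr kcol; apply/boolp.funext => -[[i x] y].
rewrite /diffusion /=.
under eq_bigr do rewrite -mulrA.
rewrite (sum_diag (fun s => _ * (gstate j \o flip N0 g f) s)) /= /gstate /flip /=.
have [jy|yj] /= := ltnP j y; last first.
  rewrite (sum_delta (fun k => sq2 * win y * ev (cheb cosf y.+1) k
    * (if (x (+) marked N0 g f k) && false then -1 else 1))).
  rewrite [(j.+1 < _)%N]ltnNge (leq_trans yj) // !andbF.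
  by rewrite (minn_idPr (leq_trans yj _)).
have mj1 : minn j.+1 y = j.+1 by apply/minn_idPl.
rewrite mj1; set p := cheb cosf j.+1.
have -> : cheb cosf j.+2 = cheb_step cosf p by [].
rewrite -ev_step.
set e1 := (if x && _ then -1 else 1); set e2 := (if x && (j.+1 < _)%N then _ else _).
(* The sign pattern of |->; the sign [e1] of the diffusion cancels it exactly in the branch y = j +
   1, which is thereby retired. *)
pose e0 : R := if x then -1 else 1.
have eE : e1 * e0 = e2.
  rewrite /e1 /e2 /e0; case: (x) => /=; last by rewrite mulr1.
  rewrite [(j.+1 < y)%N]ltn_neqAle jy andbT [j.+1 == y]eq_sym.
  by case: eqP => _; rewrite /= ?mul1r ?mulrNN ?mulr1.
transitivity (sq2 * win y * (e1 * e0) *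
    \sum_k (2 * psi i * (psi k * (sg k * ev p k)) - (i == k)%:R * (sg k * ev p k))).
  rewrite mulr_sumr; apply: eq_bigr => k _.
  rewrite (_ : (if _ && true then -1 else 1) = e0 * sg k); last first.
    rewrite /e0 /sg; case: (x); case: (marked _ _ _ _) => /=; ring.
  by ring.
rewrite eE sumrB -mulr_sumr (sum_delta (fun k => sg k * ev p k)).
by ring.
Qed.

Lemma sum_cell_rev (F : T -> R) :
  \sum_t F t = \sum_(y < 2 ^ w) \sum_(x : bool) \sum_i F (i, x, y).
Proof.
rewrite sum_cell exchange_big [RHS]exchange_big; apply: eq_bigr => x _.
exact: exchange_big.
Qed.

Lemma sum_cell_const (F : I -> 'I_(2 ^ w) -> R) :
  \sum_(t : T) F t.1.1 t.2 = 2 * \sum_(y < 2 ^ w) \sum_i F i y.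
Proof.
rewrite sum_cell_rev mulr_sumr; apply: eq_bigr => y _.
by rewrite /= sumr_const card_bool mulr_natl.
Qed.

Lemma gstate_norm j : \sum_(t : T) gstate j t ^+ 2 = \sum_(y < 2 ^ w) win y ^+ 2.
Proof.
transitivity (\sum_(t : T) sq2 ^+ 2 * (win t.2 ^+ 2 *
    ev (cheb cosf (minn j t.2).+1) t.1.1 ^+ 2)).
  apply: eq_bigr => t _; rewrite /gstate !exprMn.
  have -> : (if t.1.2 && (j < t.2)%N then -1 else 1) ^+ 2 = 1 :> R.
    by case: ifP; rewrite ?sqrrN expr1n.
  by rewrite mulr1 -mulrA.
rewrite -mulr_sumr.
rewrite (sum_cell_const (fun i y => win y ^+ 2 * ev (cheb cosf (minn j y).+1) i ^+ 2)).
rewrite mulrA sq2E mul1r; apply: eq_bigr => y _.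
by rewrite -mulr_sumr ev_form cheb_form1 mulr1.
Qed.

(** * The path operator on the counter *)

Definition hop (t t' : T) : R :=
  ((t.1.1 == t'.1.1) && (t.1.2 == t'.1.2))%:R *
  (((t.2 == t'.2.+1 :> nat)%:R + (t'.2 == t.2.+1 :> nat)%:R) / 2).

Lemma hop_sym : (kmx hop)^T = kmx hop.
Proof.
apply/matrixP => a b; rewrite !mxE /hop.
by rewrite [in LHS]eq_sym [X in _ && X]eq_sym addrC.
Qed.

Lemma sum_pick (Y k : nat) (F : nat -> R) :
  \sum_(y < Y) (y == k :> nat)%:R * F y = if (k < Y)%N then F k else 0.
Proof.
case: ltnP => hk; last first.
  rewrite big1 // => y _; case: eqP => [yk|_]; last by rewrite mul0r.
  by move: hk; rewrite -yk leqNgt ltn_ord.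
rewrite (bigD1 (Ordinal hk)) //= eqxx mul1r big1 ?addr0 // => y.
by rewrite -val_eqE /= => /negbTE ->; rewrite mul0r.
Qed.

(** The zeros of F at 0 and Y stand in for the missing neighbours at the two ends of the path. *)
Lemma sum_neighbours (Y y : nat) (F : nat -> R) : (y < Y)%N -> F 0%N = 0 -> F Y = 0 ->
  \sum_(k < Y) ((y == k.+1 :> nat)%:R + (k == y.+1 :> nat)%:R) / 2 * F k
  = (F y.-1 + F y.+1) / 2.
Proof.
move=> yY F0 FY.
under eq_bigr do rewrite mulrAC mulrDl.
rewrite -mulr_suml big_split /= sum_pick; congr ((_ + _) / 2).
  case: y yY => [|y] yY; first by rewrite F0 big1 // => k _; rewrite mul0r.
  under eq_bigr do rewrite eqSS eq_sym.
  by rewrite sum_pick ltnW.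
case: ltnP => // hy; suff -> : y.+1 = Y by [].
by apply/eqP; rewrite eqn_leq hy yY.
Qed.

Variable n : nat.
Hypothesis win_out : forall k, (n <= k)%N -> win k = 0.
Hypothesis win0 : win 0%N = 0.
Hypothesis nw : (n <= 2 ^ w)%N.

(** After n steps every branch in the support of the window is retired: its ancilla is |+> and
    branch y carries v_y = G^y psi. *)
Lemma gstate_end (t : T) :
  gstate n t = sq2 * (win t.2 * ev (cheb cosf t.2.+1) t.1.1).
Proof.
rewrite /gstate; have [nt|tn] := leqP n t.2; first by rewrite win_out // !(mulr0, mul0r).
by rewrite ltnNge (ltnW tn) andbF mulr1 -mulrA.
Qed.

(** Twice the y-component of (H - c) Phi, where [hop] is H: by 2 c v_y = v_(y+1) + v_(y-1) it equals
    (w_(y+1) - w_y) (v_(y+1) - v_(y-1)) + (w_(y+1) - 2 w_y + w_(y-1)) v_(y-1). In the code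
    [cheb_diff cosf y] is v_(y+1) - v_(y-1) and [cheb cosf y] is v_(y-1). *)
Definition residual (i : I) (y : nat) : R :=
  (win y.+1 - win y) * ev (cheb_diff cosf y) i
  + (win y.+1 - 2 * win y + win y.-1) * ev (cheb cosf y) i.

Lemma hop_residual :
  kmx hop *m kcol (gstate n) - cosf *: kcol (gstate n)
  = kcol (fun t => sq2 / 2 * residual t.1.1 t.2).
Proof.
have -> : cosf *: kcol (gstate n) = kcol (fun t => cosf * gstate n t).
  by apply/matrixP => a b; rewrite !mxE.
rewrite kmx_kcol; apply/matrixP => a b; rewrite !mxE.
case: (unpack a) => -[i x] y /=.
pose F (k : nat) : R := win k * ev (cheb cosf k.+1) i.
have -> : \sum_t hop (i, x, y) t * gstate n t = sq2 * ((F y.-1 + F y.+1) / 2).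
  rewrite -(sum_neighbours (ltn_ord y)); last first.
  - by rewrite /F win_out ?mul0r.
  - by rewrite /F win0 mul0r.
  rewrite sum_cell_rev mulr_sumr; apply: eq_bigr => k _.
  rewrite (bigD1 x) //= [X in _ + X]big1 => [|x' /negbTE xx]; last first.
    by rewrite big1 // => i' _; rewrite /hop /= [x == _]eq_sym xx andbF !mul0r.
  rewrite addr0 (bigD1 i) //= [X in _ + X]big1 => [|i' /negbTE ii]; last first.
    by rewrite /hop /= [i == _]eq_sym ii !mul0r.
  rewrite addr0 /hop /= !eqxx mul1r gstate_end /= -/(F k); ring.
rewrite gstate_end /= /residual.
have -> : F y.-1 = win y.-1 * ev (cheb cosf y) i.
  by rewrite /F; case: (nat_of_ord y) => [|//]; rewrite /= win0 !mul0r.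
rewrite /F /ev /cheb_diff.
rewrite (cheb_rec1 cosf y) (cheb_rec2 cosf y) /=.
by field.
Qed.

(** By (s + t)^2 <= 2 s^2 + 2 t^2; the first differences of the window gain the factor |v_(y+1) -
    v_(y-1)|^2 = 4 (1 - c^2) <= 16 a, where a is the mean of the digit. *)
Lemma residual_norm :
  \sum_(t : T) (sq2 / 2 * residual t.1.1 t.2) ^+ 2
  <= 8 * bitmean * \sum_(y < 2 ^ w) (win y.+1 - win y) ^+ 2
     + \sum_(y < 2 ^ w) (win y.+1 - 2 * win y + win y.-1) ^+ 2.
Proof.
rewrite (sum_cell_const (fun i y => (sq2 / 2 * residual i y) ^+ 2)).
rewrite mulr_sumr mulr_sumr -big_split /=; apply: ler_sum => y _.
set u := win y.+1 - win y; set v := _ - _ + _.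
rewrite mulr_sumr.
apply: (@le_trans _ _ (\sum_i (2^-1 * u ^+ 2 * ev (cheb_diff cosf y) i ^+ 2
    + 2^-1 * v ^+ 2 * ev (cheb cosf y) i ^+ 2))).
  apply: ler_sum => i _; rewrite /residual -/u -/v.
  set e1 := ev _ i; set e2 := ev _ i.
  have -> : 2 * (sq2 / 2 * (u * e1 + v * e2)) ^+ 2
    = (sq2 ^+ 2 * 2) * ((u * e1 + v * e2) ^+ 2 / 4) by field.
  rewrite sq2E mul1r -subr_ge0.
  have -> : 2^-1 * u ^+ 2 * e1 ^+ 2 + 2^-1 * v ^+ 2 * e2 ^+ 2 - (u * e1 + v * e2) ^+ 2 / 4
    = (u * e1 - v * e2) ^+ 2 / 4 by field.
  by rewrite divr_ge0 ?sqr_ge0.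
rewrite big_split /= -!mulr_sumr !ev_form cheb_form_diff cheb_form1 mulr1.
have -> : 4 * (1 - cosf ^+ 2) = 16 * bitmean - 16 * bitmean ^+ 2 by rewrite /cosf; ring.
have : 0 <= u ^+ 2 * bitmean ^+ 2 by rewrite mulr_ge0 ?sqr_ge0.
have : 0 <= v ^+ 2 by exact: sqr_ge0.
by lra.
Qed.

End Evolution.

(** * Estimating the mean of a digit *)

(** The change of basis [V] is absorbed into the last unitary, so that reading the canonical basis
    amounts to measuring in the eigenbasis. *)
Lemma run_column (R : realType) (d n : nat) (M : nat -> 'M[R]_d) (V : 'M[cpx R]_d)
    (Q : 'M[R]_d) (b : 'I_d) (S : nat -> 'cV[R]_d) :
  (0 < n)%N -> M 0%N *m delta_mx b 0 = S 0%N ->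
  (forall j, M j.+1 *m (Q *m S j) = S j.+1) ->
  run (fun j => let U := map_mx (real_complex R) (M j) in
                if j == n then V *m U else U) (map_mx (real_complex R) Q) n
    *m delta_mx b 0 = V *m map_mx (real_complex R) (S n) :> 'cV_d.
Proof.
case: n => // n _ M0 MS; set U := (fun j => _).
have IH j : (j <= n)%N -> run U (map_mx (real_complex R) Q) j *m delta_mx b 0
    = map_mx (real_complex R) (S j) :> 'cV_d.
  elim: j => [|j IH] jn /=.
    by rewrite /U /= -M0 map_mxM map_delta_mx.
  rewrite -!mulmxA IH 1?ltnW // /U /= ltn_eqF // -MS.
  by rewrite !map_mxM.
rewrite /= -!mulmxA IH // /U /= eqxx -mulmxA -MS.
by rewrite !map_mxM.
Qed.

(** Since [cheb _ 1] is (1, 0), no oracle sign occurs: the initial state is independent of f and can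
    be prepared by a fixed unitary. *)
Lemma gstate0E (R : realType) (N : nat) (N0 : (0 < N)%N) (g : R -> bool)
    (m1 w : nat) (f : 'I_N -> R) (win : nat -> R) (t : cell m1 w) :
  gstate N0 g f win 0 t
  = sq2 R * win t.2 * psi R N t.1.1 * (if t.1.2 && (0 < t.2)%N then -1 else 1).
Proof.
rewrite /gstate /ev min0n.
by rewrite /cheb /= mulr0 add0r oppr0 mul0r addr0 mulr1.
Qed.

Definition outcome (R : realType) (N : nat) (A : qalg0 R N) (f : 'I_N -> R) (y : nat) : R :=
  sqnorm (mxnat (Af A f) y 0).

Lemma outcome_ge0 (R : realType) (N : nat) (A : qalg0 R N) f y : 0 <= outcome A f y.
Proof. by rewrite /outcome /sqnorm addr_ge0 ?sqr_ge0. Qed.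

Lemma outcome_col (R : realType) (N : nat) (A : qalg0 R N) (f : 'I_N -> R)
    (b y : 'I_(2 ^ m_of A)) : b = 0%N :> nat ->
  outcome A f y = sqnorm ((Af A f *m (delta_mx b 0 : 'cV_(2 ^ m_of A))) y 0).
Proof.
move=> b0; rewrite -colE mxE /outcome /mxnat valK.
by have := valK b; rewrite /= b0 => ->.
Qed.

Lemma bitmean_itv (R : realType) (N : nat) (g : R -> bool) (f : 'I_N -> R) :
  (0 < N)%N -> 0 <= bitmean g f <= 1.
Proof.
move=> N0; rewrite /bitmean /SN mulr_ge0 ?sumr_ge0 ?invr_ge0 //=.
rewrite ler_pdivrMl ?ltr0n // mulr1 -[leRHS]mulr1n.
have -> : N%:R = \sum_(i < N) 1 :> R by rewrite sumr_const card_ord.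
by apply: ler_sum => i _; case: (g _); rewrite ?ler01.
Qed.

(** Here [lam] decodes the measured basis state, and the bound [e] on the mean square error may
    depend on the unknown mean. *)
Definition estimates (R : realType) (N : nat) (g : R -> bool) (A : qalg0 R N)
    (lam : nat -> R) (e : R -> R) : Prop :=
  forall f, \sum_(y < 2 ^ m_of A) outcome A f y = 1 /\
    \sum_(y < 2 ^ m_of A) outcome A f y * (lam y - bitmean g f) ^+ 2 <= e (bitmean g f).

Lemma trivial_estimate (R : realType) (N : nat) (g : R -> bool) : (0 < N)%N ->
  exists2 A : qalg0 R N, a_n A = 0%N & estimates g A (fun=> 0) (fun=> 1).
Proof.
move=> N0.
pose q := bitquery N0 g 0 N0 (ltnW (ltn_expl N (ltnSn 1))).
have U1 j : (j <= 0)%N -> unitary (1%:M : 'M[cpx R]_(2 ^ q_m q)).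
  by move=> _; rewrite /unitary map_mx1 trmx1 mulmx1.
exists (@QAlg0 R N q 0 (fun=> 1%:M) U1) => // f.
set A := QAlg0 U1.
pose b : 'I_(2 ^ m_of A) := Ordinal (expn_gt0 2 (m_of A)).
have s1 : \sum_(y < 2 ^ m_of A) outcome A f y = 1.
  under eq_bigr do rewrite (outcome_col _ _ (erefl : val b = 0%N)) mul1mx mxE andbT.
  rewrite (bigD1 b) //= big1 => [|y /negbTE ->]; rewrite /sqnorm /= !expr0n /= ?addr0 //.
  by rewrite expr1n.
split=> //; rewrite -mulr_suml s1 mul1r sub0r sqrrN.
by have /andP[a0 a1] := bitmean_itv g f N0; rewrite exprn_ile1.
Qed.

Lemma grover_estimate (R : realType) : exists2 C : R, 0 < C &
  forall (N : nat) (g : R -> bool) (h : nat), (0 < N)%N -> (0 < h)%N ->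
  exists (A : qalg0 R N) (lam : nat -> R), a_n A = (4 * h)%N /\
    estimates g A lam (fun a => C * (a / h%:R ^+ 2 + h%:R ^- 4)).
Proof.
have [C C0 winP] := window R; exists (2 * C); first by rewrite mulr_gt0.
move=> N g h N0 h0.
(* Qubits are not counted, so N of them index the arguments, as N <= 2^N, and n + 1 of them hold a
   counter exceeding n. *)
pose n := (4 * h)%N; pose w := n.+1; pose m1 := N.
have n0 : (0 < n)%N by rewrite muln_gt0.
have nw : (n < 2 ^ w)%N by rewrite (ltn_trans (ltn_expl n (ltnSn 1))) // ltn_exp2l.
have hN : (N <= 2 ^ m1)%N by rewrite ltnW // ltn_expl.
have [win [win0 win_out win1 winD winDD]] := winP h (2 ^ w)%N h0 nw.
pose q := bitquery N0 g w N0 hN.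
pose b : 'I_(2 ^ (m1 + 1 + w)) := Ordinal (expn_gt0 2 (m1 + 1 + w)).
(* The zero function is a placeholder for an arbitrary f. *)
pose init : 'cV[R]_(2 ^ (m1 + 1 + w)) := kcol (gstate N0 g (m1 := m1) (w := w) (fun=> 0) win 0).
have initE f : kcol (gstate N0 g f win 0) = init.
  by congr kcol; apply/boolp.funext => t; rewrite !gstate0E.
have norm_kcol (F : cell m1 w -> R) : \sum_a (kcol F a 0) ^+ 2 = \sum_t F t ^+ 2.
  by rewrite -sum_unpack; apply: eq_bigr => a _; rewrite mxE.
have [E0 E0u E0b] : exists2 E0 : 'M[R]_(2 ^ (m1 + 1 + w)), E0 *m E0^T = 1%:M &
    E0 *m delta_mx b 0 = init.
  apply: householder; apply/matrixP => i j; rewrite !ord1 mxE [RHS]mxE /=.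
  transitivity (\sum_a (init a 0) ^+ 2).
    by apply: eq_bigr => a _; rewrite mxE expr2.
  by rewrite norm_kcol gstate_norm.
have [V [mu [Vu muP]]] := measure_symmetric (hop_sym R m1 w).
pose M j := if j is j'.+1 then kmx (diffusion R N (m1 := m1) (w := w) j'.+1) else E0.
pose U j := let U := map_mx (real_complex R) (M j) in if j == n then V *m U else U.
have Uu j : (j <= n)%N -> unitary (U j : 'M[cpx R]_(2 ^ q_m q)).
  move=> _; have Mu : unitary (map_mx (real_complex R) (M j)).
    apply: unitary_real; case: j => [|j]; first exact: E0u.
    exact: diffusion_orthogonal.
  by rewrite /U /=; case: ifP => _ //; apply: unitaryM.
pose A := @QAlg0 R N q n U Uu.
(* The relation c = 1 - 2 a turns an eigenvalue into an estimate of a and divides the mean square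
   error by 4. *)
pose lam (y : nat) : R := if insub y is Some a then (1 - mu a) / 2 else 0.
exists A, lam; split=> // f.
pose S := kcol (gstate N0 g (m1 := m1) (w := w) f win n).
have outE (y : 'I_(2 ^ (m1 + 1 + w))) :
    outcome A f y = sqnorm ((V *m map_mx (real_complex R) S) y 0).
  rewrite (@outcome_col R N A f b y erefl) /Af /= Qmat_bitquery.
  have := @run_column R _ n M V _ b (fun j => kcol (gstate N0 g f win j)) n0.
  by move=> -> //; [rewrite initE|move=> j; apply: gstate_step].
have S1 : \sum_a (S a 0) ^+ 2 = 1 by rewrite norm_kcol gstate_norm.
have aP := bitmean_itv g f N0; set a := bitmean g f in aP *.
split.
  transitivity (\sum_y sqnorm ((V *m map_mx (real_complex R) S) y 0)).
    by apply: eq_bigr => y _; rewrite outE.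
  rewrite unitary_sqnorm // -[RHS]S1; apply: eq_bigr => y _.
  by rewrite mxE /sqnorm /= expr0n addr0.
have {}muP := muP S (cosf g f).
rewrite hop_residual // in muP; last exact: ltnW.
rewrite norm_kcol in muP.
have {muP} := le_trans muP (residual_norm N0 g w hN f win).
rewrite -/a => muP.
have -> : \sum_(y < 2 ^ m_of A) outcome A f y * (lam y - a) ^+ 2
  = 4^-1 * \sum_y sqnorm ((V *m map_mx (real_complex R) S) y 0) * (mu y - cosf g f) ^+ 2.
  rewrite mulr_sumr; apply: eq_bigr => y _; rewrite outE /lam valK /cosf -/a.
  by field.
have /andP[a0 _] := aP.
have := ler_wpM2l a0 winD.
set X := \sum_(y < _) _ in winD muP *; set Y := \sum_(y < _) _ in winDD muP *.
move=> aX; move: muP winDD; rewrite -/a.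
have C4 : 0 <= C / h%:R ^+ 4 by rewrite divr_ge0 ?exprn_ge0 // ltW.
have -> : 2 * C * (a / h%:R ^+ 2 + h%:R ^- 4) = 2 * (a * (C / h%:R ^+ 2)) + 2 * (C / h%:R ^+ 4) by ring.
move: aX; set K1 := a * (C / _); set K2 := C / _ in C4 *.
have -> : 8 * a * X = 8 * (a * X) by ring.
by set aX := a * X; lra.
Qed.

(* Budgets below one query unit are allowed: there the right-hand side exceeds
   the trivial error. *)
Lemma bit_counting (R : realType) : exists2 C : R, 1 <= C &
  forall (N : nat) (g : R -> bool) (x : R), (0 < N)%N -> 0 < x ->
  exists (A : qalg0 R N) (lam : nat -> R), (a_n A)%:R <= x /\
    estimates g A lam (fun a => C * (a / x ^+ 2 + x ^- 4)).
Proof.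
have [C C0 HC] := grover_estimate R.
exists (8 ^+ 4 * C + 4 ^+ 4).
  apply: (@le_trans _ _ (4 ^+ 4)); first by apply: exprn_ege1; rewrite ler1n.
  by rewrite lerDr mulr_ge0 ?exprn_ge0 // ltW.
move=> N g x N0 x0.
have [x4|x4] := ltP x 4.
  have [A An AP] := trivial_estimate g N0.
  exists A, (fun=> 0); split=> [|f]; first by rewrite An ltW.
  have [-> H] := AP f; split=> //; apply: le_trans H _.
  have /andP[a0 a1] := bitmean_itv g f N0.
  have X4 : 1 <= 4 ^+ 4 * x ^- 4.
    by rewrite ler_pdivlMr ?exprn_gt0 // mul1r lerXn2r ?nnegrE // ltW.
  have x4' : 0 <= x ^- 4 by rewrite invr_ge0 exprn_ge0 // ltW.
  apply: le_trans X4 _; apply: ler_pM => //.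
    by rewrite lerDr mulr_ge0 ?exprn_ge0 // ltW.
  by rewrite lerDr divr_ge0 ?exprn_ge0 // ltW.
(* Then 4 h <= x, and x >= 4 gives x < 4 (h + 1) <= 8 h, so 1 / h <= 8 / x. *)
pose h := Num.truncn (x / 4).
have xx0 : 0 <= x / 4 by rewrite divr_ge0 // ltW.
have /andP[h1 h2] := truncn_itv xx0.
have h0 : (0 < h)%N by rewrite truncn_ge_nat // ler_pdivlMr // mul1r.
have hp : 0 < h%:R :> R by rewrite ltr0n.
have hge1 : 1 <= h%:R :> R by rewrite ler1n.
have [A [lam [An AP]]] := HC N g h N0 h0.
exists A, lam; split=> [|f].
  by rewrite An natrM -ler_pdivlMl // mulrC.
have [-> H] := AP f; split=> //; apply: le_trans H _.
have /andP[a0 _] := bitmean_itv g f N0; set a := bitmean g f in a0 *.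
rewrite -!exprVn; set z := h%:R^-1; set u := x^-1.
have z0 : 0 <= z by rewrite invr_ge0.
have u0 : 0 <= u by rewrite invr_ge0 ltW.
have zu : z <= 8 * u.
  rewrite /z /u -[leLHS]mulr1 ler_pdivrMl // mulrA ler_pdivlMr // mul1r.
  have e : h.+1%:R = h%:R + 1 :> R by rewrite natr1.
  by move: h2; rewrite -/h e; lra.
have z2 : z ^+ 2 <= 8 ^+ 4 * u ^+ 2.
  apply: (@le_trans _ _ ((8 * u) ^+ 2)); first by rewrite lerXn2r ?nnegrE ?mulr_ge0.
  rewrite exprMn ler_wpM2r ?exprn_ge0 //.
  by rewrite ler_weXn2l // ler1n.
have z4 : z ^+ 4 <= 8 ^+ 4 * u ^+ 4 by rewrite -exprMn lerXn2r ?nnegrE ?mulr_ge0.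
have au0 : 0 <= a * u ^+ 2 by rewrite mulr_ge0 // exprn_ge0.
have uu0 : 0 <= u ^+ 4 by rewrite exprn_ge0.
have P0 : 0 <= a * u ^+ 2 + u ^+ 4 by rewrite addr_ge0.
apply: (@le_trans _ _ (8 ^+ 4 * C * (a * u ^+ 2 + u ^+ 4))).
  apply: le_trans (ler_wpM2l (ltW C0) (lerD (ler_wpM2l a0 z2) z4)) _.
  by rewrite le_eqVlt; apply/orP; left; apply/eqP; ring.
by rewrite ler_wpM2r // lerDl exprn_ge0.
Qed.

(** * Independent measurements *)

Lemma eq_sumtup (R : realType) (ms : seq nat) (g h : seq nat -> R) :
  (forall xs, size xs = size ms -> g xs = h xs) -> sumtup ms g = sumtup ms h.
Proof.
elim: ms g h => [|m ms IH] g h gh /=; first exact: gh.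
by apply: eq_bigr => i _; apply: IH => xs sx; apply: gh; rewrite /= sx.
Qed.

Lemma ler_sumtup (R : realType) (ms : seq nat) (g h : seq nat -> R) :
  (forall xs, size xs = size ms -> g xs <= h xs) -> sumtup ms g <= sumtup ms h.
Proof.
elim: ms g h => [|m ms IH] g h gh /=; first exact: gh.
by apply: ler_sum => i _; apply: IH => xs sx; apply: gh; rewrite /= sx.
Qed.

Lemma sumtupD (R : realType) (ms : seq nat) (g h : seq nat -> R) :
  sumtup ms (fun xs => g xs + h xs) = sumtup ms g + sumtup ms h.
Proof.
elim: ms g h => [//|m ms IH] g h /=.
by rewrite -big_split; apply: eq_bigr => i _; rewrite IH.
Qed.

Lemma sumtupZ (R : realType) (ms : seq nat) (c : R) (g : seq nat -> R) :
  sumtup ms (fun xs => c * g xs) = c * sumtup ms g.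
Proof.
elim: ms g => [//|m ms IH] g /=.
by rewrite mulr_sumr; apply: eq_bigr => i _; rewrite IH.
Qed.

Section ProductDistribution.
Variables (R : realType) (m : nat -> nat) (P : nat -> nat -> R).
Hypothesis P0 : forall l y, 0 <= P l y.
Hypothesis P1 : forall l, \sum_(y < 2 ^ m l) P l y = 1.
Variable bad : nat -> nat -> bool.

(** The offset s lets an induction on k treat the tail of a run as a run that starts at measurement
    s + 1. *)
Let joint s k (xs : seq nat) := \prod_(l < k) P (s + l)%N (nth 0%N xs l).
Let some_bad s k (xs : seq nat) := [exists l : 'I_k, bad (s + l)%N (nth 0%N xs l)].

Lemma jointS s k y xs : joint s k.+1 (y :: xs) = P s y * joint s.+1 k xs.
Proof.
rewrite /joint big_ord_recl /= addn0; congr (_ * _).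
by apply: eq_bigr => l _; rewrite /= /bump /= addnS.
Qed.

Lemma some_badS s k y xs :
  some_bad s k.+1 (y :: xs) = bad s y || some_bad s.+1 k xs.
Proof.
apply/existsP/orP => [[l]|].
  case: (unliftP ord0 l) => [j|] -> /=; last by rewrite addn0; left.
  by rewrite /bump /= add1n addnS => h; right; apply/existsP; exists j.
case=> [h|/existsP[j h]]; first by exists ord0; rewrite /= addn0.
by exists (lift ord0 j); rewrite /= /bump /= add1n addnS.
Qed.

Lemma sumtup_joint s k : sumtup [seq m l | l <- iota s k] (joint s k) = 1.
Proof.
elim: k s => [|k IH] s; first by rewrite /= /joint big_ord0.
rewrite /= -[RHS](P1 s); apply: eq_bigr => y _.
rewrite -[RHS]mulr1 -(IH s.+1) -sumtupZ; apply: eq_sumtup => xs _.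
exact: jointS.
Qed.

(** Union bound by peeling off the first outcome: either it is bad, and the remaining mass is 1, or
    the tail contains a bad outcome. *)
Lemma sumtup_union s k :
  sumtup [seq m l | l <- iota s k] (fun xs => if some_bad s k xs then joint s k xs else 0)
  <= \sum_(l < k) \sum_(y < 2 ^ m (s + l)%N) if bad (s + l)%N y then P (s + l)%N y else 0.
Proof.
elim: k s => [|k IH] s.
  rewrite /= big_ord0; case: ifP => // /existsP[[]] //.
rewrite big_ord_recl /= addn0.
apply: (@le_trans _ _ (\sum_(y < 2 ^ m s) ((if bad s y then P s y else 0) +
    P s y * sumtup [seq m l | l <- iota s.+1 k]
      (fun xs => if some_bad s.+1 k xs then joint s.+1 k xs else 0)))).
  apply: ler_sum => y _.
  rewrite -[X in X + _]mulr1 -(sumtup_joint s.+1 k) -!sumtupZ -sumtupD.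
  apply: ler_sumtup => xs _; rewrite some_badS jointS.
  have j0 : 0 <= joint s.+1 k xs by apply: prodr_ge0.
  case: (bad s y) => /=; last by rewrite mul0r add0r; case: ifP; rewrite ?mulr0.
  by rewrite lerDl mulr_ge0 //; case: ifP.
rewrite big_split /= lerD2l -mulr_suml P1 mul1r.
apply: le_trans (IH s.+1) _; rewrite le_eqVlt; apply/orP; left; apply/eqP.
by apply: eq_bigr => l _; rewrite /bump /= add1n addnS addSn.
Qed.

End ProductDistribution.

(** Every measurement starts from basis state 0 whatever came before, so the joint law is a product
    and the union bound applies. *)
Lemma assemble (R : realType) (N k : nat) (A : nat -> qalg0 R N) (phi : seq nat -> R) :
  (0 < k)%N -> exists B : qalg R N,
    nq B = (\sum_(l < k) a_n (A l))%N /\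
    forall (S : ('I_N -> R) -> R) (f : 'I_N -> R) (eps : R) (bad : nat -> nat -> bool),
      (forall l, \sum_(y < 2 ^ m_of (A l)) outcome (A l) f y = 1) ->
      (forall xs, eps < `|S f - phi xs| -> exists2 l, (l < k)%N & bad l (nth 0%N xs l)) ->
      err_prob S B f eps
        <= \sum_(l < k) \sum_(y < 2 ^ m_of (A l)) if bad l y then outcome (A l) f y else 0.
Proof.
move=> k0.
have b0 (ell : nat) (xs : seq nat) : (ell < k)%N -> size xs = ell ->
  (forall i, (i < ell)%N -> (nth 0 xs i < 2 ^ m_of (A i))%N) ->
  (0 < 2 ^ m_of (A ell))%N by rewrite expn_gt0.
exists (@QAlg R N k k0 A (fun _ _ => 0%N) b0 phi); split=> // S f eps bad A1 phiP.
rewrite /err_prob /=.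
have := @sumtup_union R (fun l => m_of (A l)) (fun l y => outcome (A l) f y)
  (fun l y => outcome_ge0 (A l) f y) A1 bad 0 k.
apply: le_trans; apply: ler_sumtup => xs _.
case: ifP => [/phiP[l lk hb]|_].
  case: ifP => // /existsP[]; by exists (Ordinal lk).
by case: ifP => // _; apply: prodr_ge0 => l _; apply: outcome_ge0.
Qed.

Lemma chebyshev_sum (R : realType) (n : nat) (P lam : nat -> R) (a e t : R) :
  (forall y, 0 <= P y) -> 0 < t ->
  \sum_(y < n) P y * (lam y - a) ^+ 2 <= e ->
  \sum_(y < n) (if t <= `|lam y - a| then P y else 0) <= e / t ^+ 2.
Proof.
move=> P0 t0 He; rewrite ler_pdivlMr ?exprn_gt0 //; apply: le_trans He.
rewrite mulr_suml; apply: ler_sum => y _; case: ifP => [ht|_].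
  rewrite ler_wpM2l // -[leRHS]real_normK ?num_real // lerXn2r ?nnegrE //.
  exact: ltW.
by rewrite mul0r mulr_ge0 // sqr_ge0.
Qed.

(** Chebyshev's inequality for each digit, then the union bound. The tolerances [t] belong to the
    analysis only and are chosen after the algorithm. *)
Lemma measure_bits (R : realType) : exists2 C : R, 1 <= C &
  forall (N k : nat) (g : nat -> R -> bool) (x : nat -> R) (Phi : (nat -> R) -> R),
  (0 < N)%N -> (0 < k)%N -> (forall l, 0 < x l) ->
  exists B : qalg R N, (nq B)%:R <= \sum_(l < k) x l /\
    forall (S : ('I_N -> R) -> R) (f : 'I_N -> R) (eps : R) (t : nat -> R),
    (forall l, 0 < t l) ->
    (forall v, (forall l, (l < k)%N -> `|v l - bitmean (g l) f| < t l) ->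
       `|S f - Phi v| <= eps) ->
    err_prob S B f eps
      <= \sum_(l < k) C * (bitmean (g l) f / x l ^+ 2 + x l ^- 4) / t l ^+ 2.
Proof.
have [C C1 HC] := bit_counting R; exists C => // N k g x Phi N0 k0 x0.
have /boolp.choice[Al AlP] : forall l, exists Al : qalg0 R N * (nat -> R),
    (a_n Al.1)%:R <= x l /\ estimates (g l) Al.1 Al.2
      (fun a => C * (a / x l ^+ 2 + x l ^- 4)).
  by move=> l; have [A [lam AP]] := HC N (g l) (x l) N0 (x0 l); exists (A, lam).
have [B [nB BP]] := @assemble R N k (fun l => (Al l).1)
  (fun xs => Phi (fun l => (Al l).2 (nth 0%N xs l))) k0.
exists B; split=> [|S f eps t t0 HPhi].
  by rewrite nB natr_sum; apply: ler_sum => l _; case: (AlP l).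
have := BP S f eps (fun l y => t l <= `|(Al l).2 y - bitmean (g l) f|).
move=> /(_ (fun l => proj1 ((proj2 (AlP l)) f))) H.
apply: le_trans (H _) _ => [xs hx|].
  apply: boolp.contrapT => nbad; move: hx; rewrite ltNge => /negP; apply.
  apply: HPhi => l lk; rewrite ltNge; apply/negP => hb.
  by apply: nbad; exists l.
apply: ler_sum => l _; apply: chebyshev_sum => //; first by move=> y; apply: outcome_ge0.
exact: (proj2 ((proj2 (AlP l)) f)).
Qed.

(** * Binary digits and the ball of L_p *)

Definition ndist (l s : nat) : nat := ((l - s) + (s - l))%N.

Lemma sum_geometric_ndist (R : realType) (r : R) (s L : nat) : 0 < r < 1 ->
  \sum_(l < L) r ^+ ndist l s <= 2 / (1 - r).
Proof.
move=> /andP[r0 r1]; rewrite ler_pdivlMr ?subr_gt0 //.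
(* The induction needs separate bounds before and after the peak s, each of them telescoping. *)
suff H : (\sum_(l < L) r ^+ ndist l s) * (1 - r)
    <= if (L <= s)%N then r ^+ (s - L).+1 else 2 - r ^+ (L - s.+1).
  apply: le_trans H _; case: ifP => _; last by rewrite gerBl exprn_ge0 // ltW.
  by apply: (@le_trans _ _ 1); [apply: exprn_ile1; exact: ltW | rewrite ler1n].
elim: L => [|L IH]; first by rewrite big_ord0 mul0r leq0n exprn_ge0 // ltW.
rewrite big_ord_recr /= mulrDl; apply: le_trans (lerD IH (lexx _)) _.
rewrite /ndist; have [Ls|Ls] := leqP L s; last first.
  rewrite leqNgt ltnS (ltnW Ls) /=.
  have -> : (s - L = 0)%N by lia.
  have -> : (L - s + 0 = (L - s.+1).+1)%N by lia.
  have -> : (L.+1 - s.+1 = (L - s.+1).+1)%N by lia.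
  have := sqr_ge0 (1 - r); rewrite expr2.
  move=> /(mulr_ge0 (exprn_ge0 (L - s.+1) (ltW r0))).
  by rewrite exprS; set X := r ^+ _; lra.
have -> : (L - s = 0)%N by lia.
rewrite add0n; move: Ls; rewrite leq_eqVlt => /predU1P[->|Ls].
  by rewrite ltnn !subnn expr0 expr1 /=; lra.
rewrite Ls; have -> : (s - L = (s - L.+1).+1)%N by lia.
by rewrite /= !exprS; set X := r ^+ _; lra.
Qed.

Section BinaryDigits.
Variables (R : realType) (U : R).
Hypothesis U0 : 0 <= U.

Definition scale (l : nat) : R := U / 2 ^+ l.

(** What a greedy expansion leaves after l digits. The first weight is U itself, so x = U is covered
    as well. *)
Fixpoint remainder (x : R) (l : nat) : R :=
  if l is l'.+1 then
    remainder x l' - (if scale l' <= remainder x l' then scale l' else 0)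
  else x.

Definition digit (l : nat) (x : R) : bool := scale l <= remainder x l.

Lemma scaleS l : scale l = 2 * scale l.+1.
Proof. by rewrite /scale exprS; field; rewrite expf_neq0. Qed.

Lemma scale_ge0 l : 0 <= scale l.
Proof. by rewrite divr_ge0 ?exprn_ge0. Qed.

Lemma remainder_itv (x : R) l : 0 <= x <= U -> 0 <= remainder x l <= 2 * scale l.
Proof.
move=> /andP[x0 xU]; elim: l => [|l /andP[IH0 IH]] /=.
  by rewrite x0 /scale expr0 divr1 (le_trans xU) // ler_peMl // ler1n.
rewrite (scaleS l) in IH *; have s0 := scale_ge0 l.+1.
by case: (leP (2 * scale l.+1) (remainder x l)) => h; apply/andP; split; lra.
Qed.

Lemma remainder_le (x : R) l : remainder x l <= x.
Proof.
elim: l => [//|l IH] /=; apply: le_trans IH; rewrite gerBl.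
by case: ifP => _ //; apply: scale_ge0.
Qed.

Lemma digit_expansion (x : R) l :
  x = \sum_(i < l) scale i * (digit i x)%:R + remainder x l.
Proof.
elim: l => [|l IH]; first by rewrite big_ord0 add0r.
rewrite big_ord_recr /= {1}IH /digit; case: ifP => _ /=; ring.
Qed.

Lemma digit_ge (x : R) l : digit l x -> scale l <= x.
Proof. by move=> h; apply: le_trans h (remainder_le _ _). Qed.

End BinaryDigits.

Lemma Bp_sum (R : realType) (N : nat) (p : R) (f : 'I_N -> R) : (0 < N)%N -> 0 < p ->
  Bp p f -> \sum_(i < N) `|f i| `^ p <= N%:R.
Proof.
move=> N0 p0; rewrite /Bp /= /LpNorm => h.
have Np : 0 < N%:R :> R by rewrite ltr0n.
suff : N%:R^-1 * \sum_(i < N) `|f i| `^ p <= 1 by rewrite ler_pdivrMl // mulr1.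
rewrite leNgt; apply/negP => h1; move: h; rewrite leNgt => /negP; apply.
have := @gt0_ltr_powR R p^-1 _ 1 (N%:R^-1 * \sum_(i < N) `|f i| `^ p).
rewrite powR1; apply; rewrite ?invr_gt0 ?nnegrE //.
by rewrite ltW // (lt_trans ltr01).
Qed.

(** One term is at most the whole sum; this allows the digits to start at weight N^(1/p). *)
Lemma Bp_le (R : realType) (N : nat) (p : R) (f : 'I_N -> R) i : (0 < N)%N -> 0 < p ->
  Bp p f -> `|f i| <= N%:R `^ p^-1.
Proof.
move=> N0 p0 fB; have := Bp_sum N0 p0 fB.
rewrite (bigD1 i) //= => h.
have {h}h : `|f i| `^ p <= N%:R.
  by apply: le_trans h; rewrite lerDl sumr_ge0 // => j _; apply: powR_ge0.
have := @ge0_ler_powR R p^-1 _ (`|f i| `^ p) N%:R.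
rewrite -powRrM divff ?gt_eqF // powRr1 //; apply; rewrite ?nnegrE ?powR_ge0 //.
by rewrite invr_ge0 ltW.
Qed.

(* Markov's inequality for the p-th power. *)
Lemma Bp_bitmean (R : realType) (N : nat) (p : R) (f : 'I_N -> R) (g : R -> bool) (l : nat) :
  (0 < N)%N -> 0 < p -> Bp p f ->
  (forall x, g x -> scale (N%:R `^ p^-1) l <= `|x|) ->
  bitmean g f <= (2 `^ p) ^+ l / N%:R.
Proof.
move=> N0 p0 fB hg; have Np : 0 < N%:R :> R by rewrite ltr0n.
rewrite /bitmean /SN mulrC ler_pM2r ?invr_gt0 //.
have P0 : 0 < (2 `^ p) ^+ l :> R by rewrite exprn_gt0 // powR_gt0.
rewrite -(ler_pM2l (x := N%:R / (2 `^ p) ^+ l)) ?divr_gt0 // mulrVK ?unitfE ?gt_eqF //.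
apply: le_trans (Bp_sum N0 p0 fB); rewrite mulr_sumr; apply: ler_sum => i _.
case hgi: (g (f i)); last by rewrite mulr0 powR_ge0.
rewrite mulr1.
have := @ge0_ler_powR R p (ltW p0) (scale (N%:R `^ p^-1) l) `|f i|.
have s0 : 0 <= scale (N%:R `^ p^-1 : R) l by rewrite scale_ge0 ?powR_ge0.
rewrite !nnegrE => /(_ s0 (normr_ge0 _) (hg _ hgi)); apply: le_trans.
rewrite /scale powRM ?powR_ge0 ?invr_ge0 ?exprn_ge0 //.
have e : (2 ^+ l : R) `^ p = (2 `^ p) ^+ l.
  by rewrite -(powR_mulrn l (ler0n R 2)) -(powR_mulrn l (powR_ge0 2 p)) -!powRrM mulrC.
have -> : (N%:R `^ p^-1) `^ p = N%:R :> R by rewrite -powRrM mulVf ?gt_eqF // powRr1.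
have -> : ((2 ^+ l)^-1 : R) `^ p = ((2 `^ p) ^+ l)^-1.
  have Pn : (2 `^ p) ^+ l != 0 :> R by rewrite gt_eqF.
  apply: (mulfI Pn); rewrite divff ?gt_eqF // -e -powRM ?invr_ge0 ?exprn_ge0 //.
  by rewrite divff ?expf_neq0 // powR1.
by [].
Qed.

(** N times the mean is an integer, and the floor after adding 1/2 rounds N v to it. *)
Lemma round_bitmean (R : realType) (N : nat) (g : R -> bool) (f : 'I_N -> R) (v : R) :
  (0 < N)%N -> `|v - bitmean g f| < (2 * N%:R)^-1 ->
  (Num.floor (N%:R * v + 2^-1))%:~R / N%:R = bitmean g f.
Proof.
move=> N0; have Np : 0 < N%:R :> R by rewrite ltr0n.
set m := (\sum_(i < N) (g (f i)))%N.
have -> : bitmean g f = m%:R / N%:R by rewrite /bitmean /SN -natr_sum mulrC.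
move=> h; congr (_ / _); rewrite (@floor_def _ _ (m : int)) //.
have {}h : `|N%:R * v - m%:R| < 2^-1.
  have -> : N%:R * v - m%:R = N%:R * (v - m%:R / N%:R) by field; rewrite gt_eqF.
  rewrite normrM gtr0_norm // -ltr_pdivlMl //.
  by rewrite -invfM [N%:R * 2]mulrC.
rewrite rmorphD /=; move: h; rewrite ltr_norml => /andP[h1 h2].
by apply/andP; split; lra.
Qed.

(** With P = 2^p and D = eta n^2 / N this gives the critical level s, the last one whose means are
    recovered exactly. *)
Lemma level_exists (R : realType) (P D : R) : 2 <= P -> 1 <= D ->
  exists s : nat, P ^+ s <= D < P ^+ s.+1.
Proof.
move=> P2 D1.
have ex : exists m, D < P ^+ m.
  exists (Num.truncn D).+1.
  have /andP[_ h] := truncn_itv (le_trans ler01 D1); apply: lt_le_trans h _.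
  apply: (@le_trans _ _ (2 ^+ (Num.truncn D).+1)).
    by rewrite -natrX ler_nat ltnW // ltn_expl.
  by rewrite lerXn2r ?nnegrE //; lra.
case: (ex_minnP ex) => -[|s] hs hmin; first by move: hs; rewrite expr0 ltNge D1.
exists s; rewrite hs andbT leNgt; apply/negP => h.
by have := hmin _ h; rewrite ltnn.
Qed.

(** * Failure probabilities and tolerances *)

(** For levels l <= s with tolerance 1 / (2M). Both error terms times M^2 are at most Y = M P^l /
    x^2, the second because it is at most Y^2 and Y <= 1. The choice of eta makes Y <= W / (8C) at l
    = s, and P r q^2 >= 1 gives the decay r^(s-l) below s. *)
Lemma failure_exact (R : realType) (C W ep eta r q P M n a x : R) (s l : nat) :
  1 <= C -> 0 < W <= 1 -> 0 < ep -> eta = ep ^+ 2 * W / (8 * C) ->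
  0 < q -> 1 <= P -> 0 < r <= 1 -> 1 <= P * (r * q ^+ 2) ->
  (l <= s)%N -> M * P ^+ s <= eta * n ^+ 2 -> 0 < M -> 0 < n ->
  a <= P ^+ l / M -> x = ep * n * q ^+ (s - l) ->
  C * (a / x ^+ 2 + x ^- 4) / (2 * M)^-1 ^+ 2 <= W * r ^+ (s - l).
Proof.
move=> C1 /andP[W0 W1] ep0 etaE q0 P1 /andP[r0 r1] Prq ls MP M0 n0 aP xE.
set d := (s - l)%N in xE *.
have C0 : 0 < C by lra.
have x0 : 0 < x by rewrite xE !mulr_gt0 ?exprn_gt0.
have P0 : 0 < P by lra.
pose Y := M * P ^+ l / x ^+ 2.
have YE : Y <= W / (8 * C) * r ^+ d.
  rewrite /Y ler_pdivrMr ?exprn_gt0 //.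
  have -> : W / (8 * C) * r ^+ d * x ^+ 2 = eta * n ^+ 2 * (r * q ^+ 2) ^+ d.
    rewrite xE etaE [(r * _) ^+ d]exprMn [(q ^+ 2) ^+ d]exprAC.
    by set z := q ^+ d; set rd := r ^+ d; field; rewrite gt_eqF.
  apply: (@le_trans _ _ (M * P ^+ s * (r * q ^+ 2) ^+ d)); last first.
    by rewrite ler_wpM2r // exprn_ge0 // mulr_ge0 ?sqr_ge0 // ltW.
  have -> : P ^+ s = P ^+ l * P ^+ d by rewrite -exprD subnKC.
  rewrite -!mulrA -exprMn ler_pM2l //; apply: ler_peMr.
    by rewrite exprn_ge0 // ltW.
  exact: exprn_ege1.
have Y0 : 0 <= Y by rewrite /Y divr_ge0 ?mulr_ge0 ?exprn_ge0 // ltW.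
have Y1 : Y <= 1.
  apply: le_trans YE _; rewrite -[leRHS]mulr1; apply: ler_pM.
  - by rewrite divr_ge0 ?mulr_ge0 // ltW.
  - by rewrite exprn_ge0 // ltW.
  - by rewrite ler_pdivrMr ?mulr_gt0 //; lra.
  - by rewrite exprn_ile1 // ltW.
have YY : Y ^+ 2 <= Y by rewrite expr2 ler_piMl.
have A1 : a / x ^+ 2 * M ^+ 2 <= Y.
  rewrite /Y mulrAC ler_pM2r ?invr_gt0 ?exprn_gt0 //.
  rewrite -ler_pdivlMr ?exprn_gt0 //; apply: le_trans aP _.
  by rewrite le_eqVlt; apply/orP; left; apply/eqP; field; rewrite gt_eqF.
have A2 : x ^- 4 * M ^+ 2 <= Y.
  apply: le_trans YY; rewrite /Y.
  have -> : x ^- 4 * M ^+ 2 = (M / x ^+ 2) ^+ 2 by field; rewrite gt_eqF.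
  have Mx : 0 <= M / x ^+ 2 by rewrite divr_ge0 ?exprn_ge0 // ltW.
  have -> : M * P ^+ l / x ^+ 2 = M / x ^+ 2 * P ^+ l by rewrite mulrAC.
  have ZP : M / x ^+ 2 <= M / x ^+ 2 * P ^+ l by apply: ler_peMr => //; apply: exprn_ege1.
  by rewrite lerXn2r ?nnegrE // (le_trans Mx).
have -> : C * (a / x ^+ 2 + x ^- 4) / (2 * M)^-1 ^+ 2
   = 4 * C * (a / x ^+ 2 * M ^+ 2 + x ^- 4 * M ^+ 2).
  by field; rewrite !gt_eqF.
apply: (@le_trans _ _ (8 * C * Y)).
  have -> : 8 * C * Y = 4 * C * (Y + Y) by ring.
  by rewrite ler_wpM2l ?lerD // mulr_ge0 // ltW.
have -> : W * r ^+ d = 8 * C * (W / (8 * C) * r ^+ d) by field; rewrite gt_eqF.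
by rewrite ler_wpM2l // mulr_ge0 // ltW.
Qed.

(** The bracket is sqrt(a) / x + 1 / x^2 with the mean a replaced by its Markov bound (4 q^8)^l /
    sM^2. The inflation q^-d, at distance d from the critical level, makes the failure probabilities
    summable. *)
Definition tolerance (R : realType) (b q x sM : R) (l d : nat) : R :=
  b / q ^+ d * ((2 * q ^+ 4) ^+ l / (sM * x) + x ^- 2).

(** The mean square error is at most C v^2 with v the bracket of [tolerance]; dividing by the
    squared tolerance leaves W (W / C) q^(2d), which is at most W r^d. *)
Lemma failure_approx (R : realType) (C W r q sM a x : R) (l d : nat) :
  1 <= C -> 0 < W <= 1 -> 0 < q <= r -> r <= 1 -> 0 < sM -> 0 < x ->
  a <= (4 * q ^+ 8) ^+ l / sM ^+ 2 ->
  C * (a / x ^+ 2 + x ^- 4) / tolerance (C / W) q x sM l d ^+ 2 <= W * r ^+ d.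
Proof.
move=> C1 /andP[W0 W1] /andP[q0 qr] r1 M0 x0 aP.
have C0 : 0 < C by lra.
pose v := (2 * q ^+ 4) ^+ l / (sM * x) + x ^- 2.
have v1 : 0 < (2 * q ^+ 4) ^+ l / (sM * x).
  by rewrite divr_gt0 ?mulr_gt0 ?exprn_gt0 ?mulr_gt0 ?exprn_gt0.
have v2 : 0 < x ^- 2 by rewrite invr_gt0 exprn_gt0.
have v0 : 0 < v by rewrite /v addr_gt0.
have av : a / x ^+ 2 + x ^- 4 <= v ^+ 2.
  have -> : v ^+ 2 = ((2 * q ^+ 4) ^+ l / (sM * x)) ^+ 2 + x ^- 4
     + 2 * ((2 * q ^+ 4) ^+ l / (sM * x)) * x ^- 2.
    by rewrite /v; set z := _ / (sM * x); field; rewrite gt_eqF.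
  rewrite -[leLHS]addr0; apply: lerD.
    2: by apply: mulr_ge0; [apply: mulr_ge0 => //|]; apply: ltW.
  rewrite lerD2r.
  have -> : ((2 * q ^+ 4) ^+ l / (sM * x)) ^+ 2
      = ((2 * q ^+ 4) ^+ l) ^+ 2 / sM ^+ 2 / x ^+ 2.
    by set z := _ ^+ l; field; rewrite !gt_eqF.
  rewrite ler_pM2r ?invr_gt0 ?exprn_gt0 //.
  apply: le_trans aP _; rewrite [(_ ^+ l) ^+ 2]exprAC.
  by have -> : (2 * q ^+ 4) ^+ 2 = 4 * q ^+ 8 by ring.
rewrite ler_pdivrMr; last by rewrite /tolerance -/v exprn_gt0 // mulr_gt0 ?divr_gt0 ?exprn_gt0.
apply: (@le_trans _ _ (C * v ^+ 2)); first by rewrite ler_pM2l.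
have rd : 0 < r ^+ d by rewrite exprn_gt0 //; lra.
have -> : W * r ^+ d * tolerance (C / W) q x sM l d ^+ 2
    = C * v ^+ 2 * (C / W * (r ^+ d / q ^+ d) / q ^+ d).
  by rewrite /tolerance -/v; field; rewrite !gt_eqF ?exprn_gt0.
apply: ler_peMr; first by rewrite mulr_ge0 ?sqr_ge0 // ltW.
have qd1 : 1 <= (q ^+ d)^-1.
  by rewrite invf_ge1 ?exprn_gt0 // exprn_ile1 //; lra.
have rq1 : 1 <= r ^+ d / q ^+ d.
  rewrite ler_pdivlMr ?exprn_gt0 // mul1r.
  by rewrite lerXn2r ?nnegrE //; lra.
have CW : 1 <= C / W by rewrite ler_pdivlMr //; lra.
by rewrite -[leLHS]mulr1 ler_pM // -[leLHS]mulr1 ler_pM.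
Qed.

(** With d = l - s the two terms carry the factors q^(2d) and (2 q^3)^-d, both at most r^d: the
    digit weights 2^-l outweigh the growing tolerances. *)
Lemma weighted_tolerance (R : realType) (U b ep r q sM n : R) (s l : nat) :
  0 <= U -> 0 <= b -> 0 < ep -> 0 < q <= r -> r <= 1 -> 1 <= 2 * q ^+ 3 * r ->
  0 < sM -> 0 < n -> (s <= l)%N ->
  scale U l * tolerance b q (ep * n * q ^+ (l - s)) sM l (l - s)
  <= U * b * (q ^+ (4 * s) / (sM * ep * n) + (2 ^+ s)^-1 / (ep * n) ^+ 2) * r ^+ (l - s).
Proof.
move=> U0 b0 ep0 /andP[q0 qr] r1 q3 M0 n0 sl; rewrite /scale /tolerance.
set d := (l - s)%N; have -> : l = (s + d)%N by rewrite subnKC.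
have qd : 0 < q ^+ d by rewrite exprn_gt0.
have r0 : 0 < r by lra.
have q1 := le_trans qr r1.
have q30 : 0 < 2 * q ^+ 3 by rewrite mulr_gt0 ?exprn_gt0.
have -> : U / 2 ^+ (s + d) * (b / q ^+ d *
      ((2 * q ^+ 4) ^+ (s + d) / (sM * (ep * n * q ^+ d)) + (ep * n * q ^+ d) ^- 2))
   = U * b * (q ^+ (4 * s) / (sM * ep * n) * (q ^+ d) ^+ 2
        + (2 ^+ s)^-1 / (ep * n) ^+ 2 * (2 * q ^+ 3) ^- d).
  have -> : (2 * q ^+ 4) ^+ (s + d) = 2 ^+ s * 2 ^+ d * (q ^+ (4 * s) * (q ^+ d) ^+ 4).
    rewrite exprMn exprD [(q ^+ 4) ^+ _]exprAC [q ^+ (s + d)]exprD.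
    by rewrite [(q ^+ s * _) ^+ 4]exprMn [q ^+ (4 * s)]exprM [(q ^+ 4) ^+ s]exprAC.
  have -> : (2 * q ^+ 3) ^+ d = 2 ^+ d * (q ^+ d) ^+ 3 by rewrite exprMn exprAC.
  rewrite exprD; have h1 : 0 < 2 ^+ s :> R by rewrite exprn_gt0.
  have h2 : 0 < 2 ^+ d :> R by rewrite exprn_gt0.
  move: qd h1 h2; set z := q ^+ d; set y := 2 ^+ s; set t := 2 ^+ d.
  set u := q ^+ (4 * s) => z0 y0 t0.
  by field; rewrite !gt_eqF.
rewrite -[leRHS]mulrA ler_wpM2l ?mulr_ge0 // [leRHS]mulrDl; apply: lerD; apply: ler_wpM2l.
- by rewrite divr_ge0 ?exprn_ge0 ?mulr_ge0 // ltW.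
- rewrite exprAC lerXn2r ?nnegrE ?sqr_ge0 ?(ltW r0) //.
  by rewrite expr2; apply: le_trans (qr); apply: ler_piMl; lra.
- by rewrite divr_ge0 ?invr_ge0 ?exprn_ge0 ?mulr_ge0 // ltW.
- rewrite -exprVn lerXn2r ?nnegrE ?invr_ge0 ?(ltW r0) ?(ltW q30) //.
  by rewrite -[leLHS]mulr1 ler_pdivrMl.
Qed.

(** * Truncated digit expansion and choice of ratios *)

Lemma max_sub_max (R : realType) (x : R) : Num.max x 0 - Num.max (- x) 0 = x.
Proof. by rewrite /Num.max; case: ltP => h1; case: ltP => h2; lra. Qed.

Lemma digits_mean (R : realType) (N : nat) (U : R) (f : 'I_N -> R) (L : nat) :
  (0 < N)%N -> (forall i, `|f i| <= U) ->
  `|SN f - \sum_(l < L) scale U l *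
      (bitmean (fun x => digit U l (Num.max x 0)) f
       - bitmean (fun x => digit U l (Num.max (- x) 0)) f)| <= 2 * scale U L.
Proof.
move=> N0 fU.
have Np : 0 < N%:R :> R by rewrite ltr0n.
have U0 : 0 <= U by apply: le_trans (fU (Ordinal N0)).
have -> : SN f - \sum_(l < L) scale U l *
      (bitmean (fun x => digit U l (Num.max x 0)) f
       - bitmean (fun x => digit U l (Num.max (- x) 0)) f)
   = N%:R^-1 * \sum_(i < N) (remainder U (Num.max (f i) 0) L
       - remainder U (Num.max (- f i) 0) L).
  rewrite /bitmean /SN.
  under [X in _ - X]eq_bigr do rewrite -mulrBr -sumrB mulrCA.
  rewrite -mulr_sumr -mulrBr; congr (_ * _).
  under [X in _ - X]eq_bigr do rewrite mulr_sumr.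
  rewrite exchange_big -sumrB /=; apply: eq_bigr => i _.
  rewrite -{1}[f i]max_sub_max.
  rewrite {1}(digit_expansion U (Num.max (f i) 0) L).
  rewrite {1}(digit_expansion U (Num.max (- f i) 0) L).
  under [X in _ - X = _]eq_bigr do rewrite mulrBr.
  by rewrite sumrB; ring.
rewrite normrM gtr0_norm ?invr_gt0 // ler_pdivrMl //.
apply: le_trans (ler_norm_sum _ _ _) _.
have -> : N%:R * (2 * scale U L) = \sum_(i < N) 2 * scale U L.
  by rewrite sumr_const card_ord mulr_natl.
apply: ler_sum => i _; have := fU i; rewrite ler_norml => /andP[f1 f2].
have /(remainder_itv U0 L)/andP[a1 a2] : 0 <= Num.max (f i) 0 <= U.
  by rewrite le_max lexx orbT ge_max f2 U0.
have /(remainder_itv U0 L)/andP[b1 b2] : 0 <= Num.max (- f i) 0 <= U.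
  by rewrite le_max lexx orbT ge_max U0 andbT lerNl.
by rewrite ler_norml; apply/andP; split; lra.
Qed.

(** The exponent of q is chosen so that 4 q^8 = 2^p. From p >= 1 follow q^8 >= 1/2 and, since 4/9 <
    1/2, q^4 >= 2/3; then r >= 3/4 suffices for both products because 2/3 times 3/4 is 1/2. *)
Lemma ratio_facts (R : realType) (p : R) : 1 <= p < 2 ->
  let q := 2 `^ (- ((2 - p) / 8)) in
  let r := Num.max (3 / 4) q in
  [/\ 0 < q < 1, q <= r < 1, 2 `^ p = 4 * q ^+ 8 :> R,
      1 <= 4 * q ^+ 8 * (r * q ^+ 2) & 1 <= 2 * q ^+ 3 * r].
Proof.
move=> /andP[p1 p2] q r.
have q0 : 0 < q by rewrite powR_gt0.
have qp : 2 `^ p = 4 * q ^+ 8 :> R.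
  rewrite /q -powR_mulrn ?powR_ge0 // -powRrM.
  have -> : 4 = 2 `^ 2 :> R by rewrite powR_mulrn // -natrX.
  by rewrite -powRD ?pnatr_eq0 ?implybT //; congr (_ `^ _); field.
have P2 : 2 <= 2 `^ p :> R by rewrite -[leLHS]powRr1 // ler_powR // ler1n.
have P4 : 2 `^ p < 4 :> R.
  have -> : 4 = 2 `^ 2 :> R by rewrite powR_mulrn // -natrX.
  by rewrite /powR (gt_eqF (ltr0n _ 2)) ltr_expR ltr_pM2r // ln_gt0 // ltr1n.
have q1 : q < 1.
  rewrite ltNge; apply/negP => /(@exprn_ege1 _ 8); move: qp P4; lra.
have q8 : 2^-1 <= q ^+ 8 by move: qp P2; lra.
have q4 : 2 / 3 <= q ^+ 4.
  rewrite leNgt; apply/negP => h; move: q8.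
  have -> : q ^+ 8 = q ^+ 4 * q ^+ 4 by rewrite -exprD.
  have h0 : 0 < q ^+ 4 by rewrite exprn_gt0.
  set z := q ^+ 4 in h h0 *.
  have : z * z <= 2 / 3 * (2 / 3) by apply: ler_pM; rewrite ltW.
  by lra.
have q2 : 2 / 3 <= q ^+ 2.
  by apply: le_trans q4 _; rewrite ler_wiXn2l // ltW.
have q3 : 2 / 3 <= q ^+ 3.
  by apply: le_trans q4 _; rewrite ler_wiXn2l // ltW.
have rq : q <= r by rewrite /r le_max lexx orbT.
have r34 : 3 / 4 <= r by rewrite /r le_max lexx.
have r1 : r < 1 by rewrite /r gt_max q1 andbT; lra.
split => //; rewrite ?q0 ?rq //.
- have h : 3 / 4 * (2 / 3) <= r * q ^+ 2 by apply: ler_pM => //; lra.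
  have : 2^-1 * (3 / 4 * (2 / 3)) <= q ^+ 8 * (r * q ^+ 2) by apply: ler_pM => //; lra.
  by lra.
- have : 2 / 3 * (3 / 4) <= q ^+ 3 * r by apply: ler_pM => //; lra.
  by lra.
Qed.

(** * The rate and the critical level *)

Definition rate (R : realType) (p : R) (n N : nat) : R :=
  n%:R `^ (- (2 / p)) * N%:R `^ (2 / p - 1).

Lemma rate_scale (R : realType) (p : R) (n N : nat) : (0 < n)%N -> (0 < N)%N -> 0 < p ->
  N%:R `^ p^-1 * (N%:R / n%:R ^+ 2) `^ p^-1 = N%:R * rate p n N.
Proof.
move=> n0 N0 p0.
have np : 0 < n%:R :> R by rewrite ltr0n.
have Np : 0 < N%:R :> R by rewrite ltr0n.
rewrite powRM ?invr_ge0 ?exprn_ge0 // /rate.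
have -> : (n%:R ^- 2 : R) `^ p^-1 = n%:R `^ (- (2 / p)).
  by rewrite -powR_invn // -powRrM mulNr.
rewrite mulrA mulrC [RHS]mulrCA; congr (_ * _).
have -> : N%:R * N%:R `^ (2 / p - 1) = N%:R `^ (2 / p) :> R.
  by rewrite mulr_powRB1 // divr_gt0.
rewrite -powRD; last by rewrite pnatr_eq0 -lt0n N0 implybT.
by congr (_ `^ _); field; rewrite gt_eqF.
Qed.

(** The p-th root of the upper inequality defining s: the weight 2^-s is of order (N /
    n^2)^(1/p). *)
Lemma depth_bound (R : realType) (p eta : R) (n N s : nat) :
  (0 < n)%N -> (0 < N)%N -> 0 < p -> 0 < eta ->
  eta * n%:R ^+ 2 / N%:R < (2 `^ p) ^+ s.+1 ->
  (2 ^+ s)^-1 <= 2 * eta^-1 `^ p^-1 * (N%:R / n%:R ^+ 2) `^ p^-1.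
Proof.
move=> n0 N0 p0 eta0 hs.
have np : 0 < n%:R :> R by rewrite ltr0n.
have Np : 0 < N%:R :> R by rewrite ltr0n.
have D0 : 0 < eta * n%:R ^+ 2 / N%:R by rewrite divr_gt0 // mulr_gt0 // exprn_gt0.
rewrite -mulrA -powRM ?invr_ge0 ?divr_ge0 ?exprn_ge0 ?(ltW eta0) //.
have -> : eta^-1 * (N%:R / n%:R ^+ 2) = (eta * n%:R ^+ 2 / N%:R)^-1.
  by field; rewrite !gt_eqF.
have -> : (2 ^+ s)^-1 = 2 * ((2 `^ p) ^+ s.+1)^-1 `^ p^-1 :> R.
  rewrite -powR_invn ?powR_ge0 // -powRrM -powRrM.
  have -> : p * (- s.+1%:R / p) = - s.+1%:R by field; rewrite gt_eqF.
  by rewrite powR_invn // exprS invfM mulrA divff // mul1r.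
rewrite ler_pM2l //; apply: ge0_ler_powR; rewrite ?nnegrE ?invr_ge0 ?exprn_ge0 ?powR_ge0 //.
- exact: ltW.
- exact: ltW.
- by rewrite lef_pV2 ?posrE ?exprn_gt0 ?powR_gt0 // ltW.
Qed.

(** Since q^(8s) = (2^p)^s 4^-s and (2^p)^s <= n^2 / N, both terms are of order 2^-s / N; then
    [depth_bound] and [rate_scale] apply. *)
Lemma tail_constant (R : realType) (p eta q b ep : R) (n N s : nat) :
  (0 < n)%N -> (0 < N)%N -> 0 < p -> 0 < eta <= 1 -> 0 < q -> 0 <= b -> 0 < ep ->
  2 `^ p = 4 * q ^+ 8 ->
  (2 `^ p) ^+ s <= eta * n%:R ^+ 2 / N%:R < (2 `^ p) ^+ s.+1 -> N%:R <= n%:R ^+ 2 :> R ->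
  N%:R `^ p^-1 * b * (q ^+ (4 * s) / (Num.sqrt N%:R * ep * n%:R)
     + (2 ^+ s)^-1 / (ep * n%:R) ^+ 2)
  <= b * (2 * eta^-1 `^ p^-1) * (ep^-1 + ep ^- 2) * rate p n N.
Proof.
move=> n0 N0 p0 /andP[eta0 eta1] q0 b0 ep0 qp /andP[hs1 hs2] Nn.
have np : 0 < n%:R :> R by rewrite ltr0n.
have Np : 0 < N%:R :> R by rewrite ltr0n.
have Sp : 0 < Num.sqrt N%:R :> R by rewrite sqrtr_gt0.
have SN2 : Num.sqrt N%:R ^+ 2 = N%:R :> R by rewrite sqr_sqrtr // ltW.
move: Sp SN2; set sN := Num.sqrt N%:R => Sp SN2; clearbody sN.
have e2 := depth_bound n0 N0 p0 eta0 hs2.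
have UH := rate_scale n0 N0 p0.
set U := N%:R `^ p^-1 in UH *; set h := (_ / _) `^ _ in UH e2.
set e1 := 2 * _ in e2 *.
have U0 : 0 <= U by rewrite powR_ge0.
have h0 : 0 <= h by rewrite powR_ge0.
have e10 : 0 <= e1 by rewrite mulr_ge0 // powR_ge0.
clearbody U h e1.
have T0 : 0 <= rate p n N by rewrite mulr_ge0 // powR_ge0.
have s0 : 0 <= (2 ^+ s)^-1 :> R by rewrite invr_ge0 exprn_ge0.
have A1 : q ^+ (4 * s) / (sN * n%:R) <= e1 * h / N%:R.
  have l0 : 0 <= q ^+ (4 * s) / (sN * n%:R).
    by rewrite divr_ge0 ?exprn_ge0 ?mulr_ge0 // ltW.
  have r0 : 0 <= e1 * h / N%:R by rewrite divr_ge0 ?mulr_ge0.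
  rewrite -(ler_pXn2r (n := 2)) ?nnegrE //.
  have -> : (q ^+ (4 * s) / (sN * n%:R)) ^+ 2
      = (2 `^ p) ^+ s * (2 ^+ s)^-1 ^+ 2 / (N%:R * n%:R ^+ 2).
    rewrite qp -SN2.
    have -> : (4 * q ^+ 8) ^+ s = (2 ^+ s) ^+ 2 * (q ^+ (4 * s)) ^+ 2.
      have -> : 4 * q ^+ 8 = (2 * q ^+ 4) ^+ 2 by ring.
      by rewrite exprAC [(2 * q ^+ 4) ^+ s]exprMn [q ^+ (4 * s)]exprM exprMn.
    have : 0 < 2 ^+ s :> R by rewrite exprn_gt0.
    set y := 2 ^+ s; set z := q ^+ (4 * s) => y0.
    by field; rewrite !gt_eqF.
  have D1 : (2 `^ p) ^+ s <= n%:R ^+ 2 / N%:R.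
    by apply: le_trans hs1 _; rewrite -mulrA ler_piMl // divr_ge0 ?exprn_ge0.
  have D2 : (2 ^+ s)^-1 ^+ 2 <= (e1 * h) ^+ 2.
    by rewrite lerXn2r ?nnegrE ?mulr_ge0.
  rewrite ler_pdivrMr; last by rewrite mulr_gt0 ?exprn_gt0.
  apply: (@le_trans _ _ (n%:R ^+ 2 / N%:R * (e1 * h) ^+ 2)).
    by apply: ler_pM; rewrite ?exprn_ge0 ?powR_ge0.
  by rewrite le_eqVlt; apply/orP; left; apply/eqP; field; rewrite gt_eqF.
have A2 : (2 ^+ s)^-1 / n%:R ^+ 2 <= e1 * h / N%:R.
  apply: ler_pM => //.
  by rewrite lef_pV2 ?posrE ?exprn_gt0.
have -> : b * e1 * (ep^-1 + ep ^- 2) * rate p n N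
   = U * b * (e1 * h / N%:R * ep^-1 + e1 * h / N%:R * ep ^- 2).
  have -> : U * b * (e1 * h / N%:R * ep^-1 + e1 * h / N%:R * ep ^- 2)
    = b * e1 * (ep^-1 + ep ^- 2) * (U * h / N%:R) by ring.
  by rewrite UH [N%:R * _]mulrC mulfK // gt_eqF.
rewrite ler_wpM2l ?mulr_ge0 //; apply: lerD.
- have -> : q ^+ (4 * s) / (sN * ep * n%:R)
     = q ^+ (4 * s) / (sN * n%:R) * ep^-1.
    by set z := q ^+ _; field; rewrite !gt_eqF.
  by rewrite ler_wpM2r // invr_ge0 ltW.
- have -> : (2 ^+ s)^-1 / (ep * n%:R) ^+ 2 = (2 ^+ s)^-1 / n%:R ^+ 2 * ep ^- 2 :> R.
    by set z := (_ ^+ s)^-1; field; rewrite !gt_eqF.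
  by rewrite ler_wpM2r // invr_ge0 exprn_ge0 // ltW.
Qed.

(** * The mean of a p-summable sequence *)

(** One list of 2L measurements: the first L for the positive part, the others for the negative
    part. *)
Definition level_digit (R : realType) (U : R) (L l : nat) (x : R) : bool :=
  if (l < L)%N then digit U l (Num.max x 0) else digit U (l - L) (Num.max (- x) 0).

Definition level_index (L l : nat) : nat := if (l < L)%N then l else (l - L)%N.

Lemma level_bitmean (R : realType) (N : nat) (p : R) (f : 'I_N -> R) (L l : nat) :
  (0 < N)%N -> 0 < p -> Bp p f ->
  bitmean (level_digit (N%:R `^ p^-1) L l) f <= (2 `^ p) ^+ level_index L l / N%:R.
Proof.
move=> N0 p0 fB; apply: Bp_bitmean => // x.
have U0 : 0 <= N%:R `^ p^-1 :> R by rewrite powR_ge0.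
rewrite /level_digit /level_index; case: ifP => _ /(digit_ge U0) h; apply: le_trans h _.
  by rewrite ge_max ler_norm normr_ge0.
by rewrite ge_max -normrN ler_norm normr_ge0.
Qed.

Lemma sum_levels (R : realType) (L : nat) (F : nat -> R) :
  \sum_(l < L + L) F (level_index L l) = 2 * \sum_(l < L) F l.
Proof.
rewrite big_split_ord /= [2 * _]mulr_natl mulr2n; congr (_ + _).
  by apply: eq_bigr => l _; rewrite /level_index ltn_ord.
by apply: eq_bigr => l _; rewrite /level_index ltnNge leq_addr /= addKn.
Qed.

(** L may be as large as needed: the budgets are summable over all levels, so the query bound is
    independent of L. *)
Lemma truncation_depth (R : realType) (U T : R) : 0 < T ->
  exists2 L : nat, (0 < L)%N & 2 * scale U L <= T.
Proof.
move=> T0; exists (Num.truncn (`|2 * U / T|)).+1 => //.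
have /andP[_ h] := truncn_itv (normr_ge0 (2 * U / T)).
rewrite /scale mulrA ler_pdivrMr ?exprn_gt0 // [T * _]mulrC -ler_pdivrMr //.
apply: le_trans (ler_norm _) _; apply: ltW; apply: lt_le_trans h _.
by rewrite -natrX ler_nat ltnW // ltn_expl.
Qed.

Lemma quantum_mean (R : realType) (p : R) : 1 <= p < 2 ->
  exists c0 c : R, 0 < c0 /\ 0 < c /\
    forall n N : nat, (0 < n)%N -> (0 < N)%N -> c0 * Num.sqrt N%:R <= n%:R ->
    exists2 B : qalg R N, (nq B <= n)%N &
      forall f, Bp p f -> err_prob (@SN R N) B f (c * rate p n N) <= 4^-1.
Proof.
move=> p12; have /andP[p1 p2] := p12; have p0 : 0 < p by lra.
have [C C1 HC] := measure_bits R.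
have [] := ratio_facts p12.
set q := 2 `^ _; set r := Num.max _ _.
move=> /andP[q0 q1] /andP[qr r1] qp Prq q3; clearbody r q.
have C0 : 0 < C by lra.
have r0 : 0 < r by lra.
(* Over both signs the budgets sum to at most 4 ep n / (1 - q) = n and the failure probabilities to
   at most 4 W / (1 - r) = 1/4. *)
have [ep epE] : exists ep, ep = (1 - q) / 4 by eexists.
have [W WE] : exists W, W = (1 - r) / 16 by eexists.
have [eta etaE] : exists eta, eta = ep ^+ 2 * W / (8 * C) by eexists.
have [b bE] : exists b, b = C / W by eexists.
have ep0 : 0 < ep by rewrite epE; lra.
have ep1 : ep <= 1 by rewrite epE; lra.
have W01 : 0 < W <= 1 by rewrite WE; apply/andP; split; lra.
have /andP[W0 W1] := W01.
have eta0 : 0 < eta by rewrite etaE divr_gt0 ?mulr_gt0 ?exprn_gt0.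
have eta1 : eta <= 1.
  rewrite etaE ler_pdivrMr ?mulr_gt0 // mul1r.
  have : ep ^+ 2 * W <= 1 * 1.
    apply: ler_pM; rewrite ?sqr_ge0 ?(ltW W0) //.
    by rewrite exprn_ile1 // ltW.
  by lra.
have b0 : 0 < b by rewrite bE divr_gt0.
have [K KE] : exists K, K = b * (2 * eta^-1 `^ p^-1) * (ep^-1 + ep ^- 2) by eexists.
have K0 : 0 < K.
  by rewrite KE !mulr_gt0 ?powR_gt0 ?addr_gt0 ?invr_gt0 ?exprn_gt0.
(* The first constant ensures eta n^2 / N >= 1, so that a critical level exists. In the second, 1
   pays for truncation and the rest for the geometric sum over levels and signs. *)
exists (Num.sqrt eta)^-1, (4 * K / (1 - r) + 1).
split; first by rewrite invr_gt0 sqrtr_gt0.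
split; first by rewrite addr_gt0 // divr_gt0 ?mulr_gt0 //; lra.
move=> n N n0 N0 hn.
have np : 0 < n%:R :> R by rewrite ltr0n.
have Np : 0 < N%:R :> R by rewrite ltr0n.
have Nn : N%:R <= eta * n%:R ^+ 2 :> R.
  have h : Num.sqrt N%:R <= Num.sqrt eta * n%:R :> R.
    by rewrite -ler_pdivrMl ?sqrtr_gt0.
  have : Num.sqrt N%:R ^+ 2 <= (Num.sqrt eta * n%:R) ^+ 2 :> R.
    by rewrite lerXn2r ?nnegrE ?mulr_ge0 ?sqrtr_ge0.
  by rewrite exprMn !sqr_sqrtr // ltW.
have Nn1 : N%:R <= n%:R ^+ 2 :> R.
  by apply: le_trans Nn _; rewrite ler_piMl // exprn_ge0.
set P := 2 `^ p in qp; rewrite -qp in Prq.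
have P2 : 2 <= P by rewrite /P -[leLHS]powRr1 // ler_powR // ler1n.
have [s sP] : exists s, P ^+ s <= eta * n%:R ^+ 2 / N%:R < P ^+ s.+1.
  by apply: level_exists => //; rewrite ler_pdivlMr // mul1r.
have /andP[sP1 _] := sP; rewrite ler_pdivlMr // mulrC in sP1.
pose U : R := N%:R `^ p^-1.
have U0 : 0 <= U by rewrite powR_ge0.
have T0 : 0 < rate p n N by rewrite mulr_gt0 ?powR_gt0.
have [L L0 HL] := truncation_depth U T0.
pose idx := level_index L.
pose x (l : nat) := ep * n%:R * q ^+ ndist (idx l) s.
have x0 l : 0 < x l by rewrite !mulr_gt0 ?exprn_gt0.
(* Up to the critical level estimates are rounded to multiples of 1 / N; beyond it they are used as
   they are. *)
pose Psi (l : nat) (v : R) : R :=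
  if (idx l <= s)%N then (Num.floor (N%:R * v + 2^-1))%:~R / N%:R else v.
pose Phi (v : nat -> R) : R :=
  \sum_(l < L) scale U l * (Psi l (v l) - Psi (L + l)%N (v (L + l)%N)).
pose t (l : nat) : R := if (idx l <= s)%N then (2 * N%:R)^-1
  else tolerance b q (x l) (Num.sqrt N%:R) (idx l) (ndist (idx l) s).
have sN0 : 0 < Num.sqrt N%:R :> R by rewrite sqrtr_gt0.
have t0 l : 0 < t l.
  rewrite /t; case: ifP => _; first by rewrite invr_gt0 mulr_gt0.
  apply: mulr_gt0; first by rewrite divr_gt0 ?exprn_gt0.
  apply: addr_gt0; last by rewrite invr_gt0 exprn_gt0.
  apply: divr_gt0; last exact: mulr_gt0.
  by rewrite exprn_gt0 // mulr_gt0 // exprn_gt0.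
have LL : (0 < L + L)%N by rewrite addn_gt0 L0.
have [B [nB BP]] := HC N (L + L)%N (level_digit U L) x Phi N0 LL x0.
exists B.
  rewrite -(ler_nat R); apply: le_trans nB _.
  rewrite (sum_levels L (fun l => ep * n%:R * q ^+ ndist l s)) -mulr_sumr.
  have := @sum_geometric_ndist R q s L; rewrite q0 q1 => /(_ isT) h.
  have e0 : 0 <= 2 * (ep * n%:R) by rewrite !mulr_ge0 // ltW.
  rewrite mulrA; apply: le_trans (ler_wpM2l e0 h) _.
  rewrite epE le_eqVlt; apply/orP; left; apply/eqP; field.
  by rewrite gt_eqF //; lra.
move=> f fB; apply: le_trans (BP (@SN R N) f _ t t0 _) _.
- move=> v hv.
  have hM := digits_mean L N0 (fun i => Bp_le i N0 p0 fB).
  pose Z := U * b * (q ^+ (4 * s) / (Num.sqrt N%:R * ep * n%:R)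
     + (2 ^+ s)^-1 / (ep * n%:R) ^+ 2).
  have ZK : Z <= K * rate p n N.
    by rewrite KE; apply: tail_constant => //; rewrite ?eta0 // ltW.
  have Z0 : 0 <= Z.
    rewrite /Z !mulr_ge0 ?(ltW b0) // addr_ge0 // divr_ge0 ?invr_ge0 ?exprn_ge0 ?mulr_ge0 ?sqrtr_ge0 ?(ltW q0) ?(ltW ep0) //.
  (* The weighted error of one level: zero when rounding is exact, geometrically decaying beyond
     s. *)
  have lev l : (l < L + L)%N ->
      scale U (idx l) * `|bitmean (level_digit U L l) f - Psi l (v l)| <= Z * r ^+ ndist (idx l) s.
    move=> /hv; rewrite /Psi /t; case: ifP => hs.
      move=> /(round_bitmean N0) ->; rewrite subrr normr0 mulr0.
      by rewrite mulr_ge0 // exprn_ge0 // ltW.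
    have sl : (s <= idx l)%N by rewrite leqNgt; apply/negP => h; rewrite ltnW in hs.
    have dE : ndist (idx l) s = (idx l - s)%N by rewrite /ndist (eqP sl) addn0.
    rewrite distrC => /ltW h; apply: le_trans (ler_wpM2l (scale_ge0 U0 _) h) _.
    rewrite /x dE; apply: weighted_tolerance => //; rewrite ?q0 ?qr ?ltW //.
  have h2 : `|\sum_(l < L) scale U l *
      (bitmean (fun x => digit U l (Num.max x 0)) f
       - bitmean (fun x => digit U l (Num.max (- x) 0)) f) - Phi v|
      <= \sum_(l < L) 2 * (Z * r ^+ ndist l s).
    rewrite /Phi -sumrB; apply: le_trans (ler_norm_sum _ _ _) _.
    apply: ler_sum => l _.
    have i1 : idx l = l by rewrite /idx /level_index ltn_ord.
    have i2 : idx (L + l)%N = l.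
      by rewrite /idx /level_index ltnNge leq_addr /= addKn.
    have l1 : (l < L + L)%N by rewrite (leq_trans (ltn_ord l)) // leq_addr.
    have l2 : (L + l < L + L)%N by rewrite ltn_add2l.
    have := lev _ l1; have := lev _ l2; rewrite i1 i2.
    have -> : level_digit U L l = (fun x => digit U l (Num.max x 0)).
      by apply/boolp.funext => y; rewrite /level_digit ltn_ord.
    have -> : level_digit U L (L + l) = (fun x => digit U l (Num.max (- x) 0)).
      by apply/boolp.funext => y; rewrite /level_digit ltnNge leq_addr /= addKn.
    set a1 := bitmean _ f; set a2 := bitmean _ f => h2 h1.
    rewrite -mulrBr normrM ger0_norm ?scale_ge0 //.
    have -> : a2 - a1 - (Psi l (v l) - Psi (L + l)%N (v (L + l)%N))
      = (a2 - Psi l (v l)) - (a1 - Psi (L + l)%N (v (L + l)%N)) by ring.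
    apply: le_trans (ler_wpM2l (scale_ge0 U0 l) (ler_normB _ _)) _.
    by rewrite mulrDr; lra.
  rewrite -mulr_sumr -mulr_sumr in h2.
  have := @sum_geometric_ndist R r s L; rewrite r0 r1 => /(_ isT) hr.
  have h3 : 2 * (Z * \sum_(l < L) r ^+ ndist l s) <= 2 * (K * rate p n N * (2 / (1 - r))).
    rewrite ler_pM2l //; apply: ler_pM => //.
    by apply: sumr_ge0 => l _; rewrite exprn_ge0 // ltW.
  have -> : (4 * K / (1 - r) + 1) * rate p n N
     = rate p n N + 2 * (K * rate p n N * (2 / (1 - r))).
    by field; rewrite gt_eqF //; lra.
  have hM' := le_trans hM HL; have h2' := le_trans h2 h3.
  apply: le_trans (lerD hM' h2').
  exact: ler_distD.
- apply: (@le_trans _ _ (\sum_(l < L + L) W * r ^+ ndist (idx l) s)).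
    apply: ler_sum => l _.
    have aP := level_bitmean L l N0 p0 fB.
    rewrite -/idx -/P in aP.
    rewrite /t; case: ifP => hs.
      have dE : ndist (idx l) s = (s - idx l)%N by rewrite /ndist (eqP hs).
      rewrite dE; apply: (@failure_exact R C W ep eta r q P N%:R n%:R) => //.
      + by lra.
      + by rewrite r0 ltW.
      + by rewrite /x dE.
    rewrite bE; apply: failure_approx => //; rewrite ?q0 ?qr ?(ltW r1) //.
    by rewrite sqr_sqrtr // -qp.
  rewrite (sum_levels L (fun l => W * r ^+ ndist l s)) -mulr_sumr mulrA.
  have := @sum_geometric_ndist R r s L; rewrite r0 r1 => /(_ isT) hr.
  have e0 : 0 <= 2 * W by rewrite mulr_ge0 // ltW.
  apply: le_trans (ler_wpM2l e0 hr) _.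
  rewrite WE le_eqVlt; apply/orP; left; apply/eqP; field.
  by rewrite gt_eqF //; lra.
Qed.

Theorem theorem3 (R : realType) (p : R) :
  1 <= p < 2 ->
  exists c0 c : R, 0 < c0 /\ 0 < c /\
    forall n N : nat, (0 < n)%N -> (0 < N)%N ->
      c0 * Num.sqrt (N%:R) <= n%:R ->
      (@eq_min R N n (@SN R N) (@Bp R N p)
        <= (c * n%:R `^ (- (2 / p)) * N%:R `^ (2 / p - 1)
              * (Num.max (log2 (n%:R / Num.sqrt (N%:R))) 1) `^ (2 / p - 1))%:E)%E.
Proof.
move=> p12; have /andP[p1 p2] := p12.
have [c0 [c [c00 [c1 H]]]] := quantum_mean p12.
exists c0, c; split=> //; split=> // n N n0 N0 hn.
have [B nB BP] := H n N n0 N0 hn.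
apply: (@le_trans _ _ (err_F (@SN R N) B (@Bp R N p))).
  by apply: ereal_inf_lbound; exists B.
apply: ge_ereal_sup => _ [f fB <-].
apply: (@le_trans _ _ (c * rate p n N)%:E).
  by apply: ereal_inf_lbound; exists (c * rate p n N) => //; apply: BP.
rewrite lee_fin /rate mulrA ler_peMr //.
  by rewrite !mulr_ge0 ?powR_ge0 // ltW.
(* As 2/p - 1 >= 0, the power of this maximum is at least 1 and only enlarges the bound. *)
set z := Num.max _ _; have z1 : 1 <= z by rewrite le_max lexx orbT.
have e0 : 0 <= 2 / p - 1 by rewrite subr_ge0 ler_pdivlMr; lra.
by have := ler_powR z1 e0; rewrite powRr0.
Qed.
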